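(* Let $X$ be a connected, locally path connected space. Then $X$ has a small generated covering if and only if $X$ is semi-locally small generated. Also, every small generated covering of $X$ is a universal covering of $X$.
   Context: All homotopies of paths are relative to end points. For a space $Y$ and $y\in Y$, the small loop group $\pi_1^s(Y,y)\le \pi_1(Y,y)$ is the subgroup of all classes $[\beta]$ of loops $\beta$ at $y$ such that for every open neighborhood $V$ of $y$, $\beta$ is homotopic to a loop at $y$ lying in $V$. The SG (small generated) subgroup $\pi_1^{sg}(Y,y)$ is the subgroup of $\pi_1(Y,y)$ generated by all elements $[\alpha*\beta*\alpha^{-1}]$, where $\alpha$ is a path in $Y$ with $\alpha(0)=y$ and $[\beta]\in\pi_1^s(Y,\alpha(1))$. A space $Y$ is small generated if $\pi_1(Y,y)=\pi_1^{sg}(Y,y)$ for every $y\in Y$. A small generated covering of $X$ is a covering $p:\widetilde X\to X$ with $\widetilde X$ path connected such that $\widetilde X$ is a small generated space. A space $X$ is semi-locally small generated if for each $x\in X$ there is an open neighborhood $U$ of $x$ such that $i_*\pi_1(U,x)\le \pi_1^{sg}(X,x)$, where $i:U\hookrightarrow X$ is the inclusion. A universal covering (in the categorical sense) of $X$ is a covering $p:\widetilde X\to X$ with $\widetilde X$ path connected such that, with base points $x\in X$ and $\tilde x\in p^{-1}(\{x\})$, for every covering $q:(\widetilde Y,\tilde y)\to (X,x)$ with $\widetilde Y$ path connected there exists a unique base-point-preserving covering $r:(\widetilde X,\tilde x)\to(\widetilde Y,\tilde y)$ with $q\circ r=p$. *)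

(* Defs.v *)
From HB Require Import structures.
From mathcomp Require Import all_boot all_order all_algebra generic_quotient.
From mathcomp Require Import all_classical reals topology normedtype homotopy.
From mathcomp Require Import ring lra.

Set Implicit Arguments.
Unset Strict Implicit.
Unset Printing Implicit Defensive.

Import Order.TTheory GRing.Theory Num.Theory.
Import numFieldNormedType.Exports.

Local Open Scope classical_set_scope.
Local Open Scope ring_scope.
Local Open Scope quotient_scope.

Section unit_interval.
Variable R : realType.

Definition unit_interval : Type := set_type `[(0 : R), 1].
HB.instance Definition _ := Topological.on unit_interval.

(* Real formulas defining paths are sent back to the interval by [toI], which
   truncates to [0, 1]; it is the identity on [0, 1] (see [clampK]). *)
Definition clamp (t : R) : R := Num.min 1 (Num.max 0 t).

Lemma clamp_itv t : clamp t \in `[(0 : R), 1]%classic.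
Proof.
by rewrite inE /= in_itv /= /clamp le_min ler01 le_max lexx ge_min lexx.
Qed.

Lemma clampK t : 0 <= t <= 1 -> clamp t = t.
Proof. by case/andP => t0 t1; rewrite /clamp max_r // min_r. Qed.

Lemma clamp_le0 t : t <= 0 -> clamp t = 0.
Proof. by move=> t0; rewrite /clamp max_l // min_r. Qed.

Lemma clamp_ge1 t : 1 <= t -> clamp t = 1.
Proof. by move=> t1; rewrite /clamp max_r ?min_l // (le_trans _ t1). Qed.

Definition toI (t : R) : unit_interval := SigSub (clamp_itv t).

Definition ival (s : unit_interval) : R := val s.
Arguments ival : simpl never.

Lemma ival_toI t : ival (toI t) = clamp t. Proof. by []. Qed.

Lemma ival_itv (s : unit_interval) : 0 <= ival s <= 1.
Proof. by have := valP s; rewrite inE /= in_itv. Qed.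

Lemma ival_ge0 (s : unit_interval) : 0 <= ival s.
Proof. by case/andP: (ival_itv s). Qed.

Lemma ival_le1 (s : unit_interval) : ival s <= 1.
Proof. by case/andP: (ival_itv s). Qed.

Lemma toI_ival (s : unit_interval) : toI (ival s) = s.
Proof. by apply: val_inj; rewrite /= clampK // ival_itv. Qed.

Lemma unit_interval_neq : toI 0 != toI 1.
Proof.
apply/eqP => /(congr1 val) /=; rewrite clamp_le0 // clamp_ge1 //.
by move/esym/eqP; rewrite oner_eq0.
Qed.

HB.instance Definition _ := isBiPointed.Build unit_interval unit_interval_neq.

Lemma ival_zero : ival (zero : unit_interval) = 0.
Proof. exact: clamp_le0. Qed.

Lemma ival_one : ival (one : unit_interval) = 1.
Proof. exact: clamp_ge1. Qed.

Lemma toI_le0 t : t <= 0 -> toI t = zero.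
Proof. by move=> t0; apply: val_inj; rewrite /= !clamp_le0. Qed.

Lemma toI_ge1 t : 1 <= t -> toI t = one.
Proof. by move=> t1; apply: val_inj; rewrite /= !clamp_ge1. Qed.

Lemma continuous_ival : continuous (ival : unit_interval -> R).
Proof. exact: initial_continuous. Qed.

Lemma continuous_clamp : continuous clamp.
Proof.
move=> t; apply: (@continuous_min R R^o (cst 1) (fun t => Num.max 0 t)).
  exact: cst_continuous.
apply: (@continuous_max R R^o (cst 0) id) => //.
exact: cst_continuous.
Qed.

Lemma continuous_toI : continuous toI.
Proof.
apply: (@continuous_comp_initial _ R R set_val toI).
have -> : set_val \o toI = clamp by rewrite set_valE.
exact: continuous_clamp.
Qed.

End unit_interval.

Section continuity_lemmas.
Context {R : realType} {T : topologicalType}.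

Lemma contC {Y Z : topologicalType} (f : T -> Y) (g : Y -> Z) :
  continuous f -> continuous g -> continuous (fun t => g (f t)).
Proof. by move=> cf cg t; apply: continuous_comp; [exact: cf|exact: cg]. Qed.

Lemma contP {Y Z : topologicalType} (f : T -> Y) (g : T -> Z) :
  continuous f -> continuous g -> continuous (fun t => (f t, g t)).
Proof. by move=> cf cg t; apply: cvg_pair; [exact: cf|exact: cg]. Qed.

Lemma contD (f g : T -> R) :
  continuous f -> continuous g -> continuous (fun t => f t + g t).
Proof. by move=> cf cg t; apply: cvgD; [exact: cf|exact: cg]. Qed.

Lemma contB (f g : T -> R) :
  continuous f -> continuous g -> continuous (fun t => f t - g t).
Proof. by move=> cf cg t; apply: cvgB; [exact: cf|exact: cg]. Qed.

Lemma contM (f g : T -> R) :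
  continuous f -> continuous g -> continuous (fun t => f t * g t).
Proof. by move=> cf cg t; apply: cvgM; [exact: cf|exact: cg]. Qed.

Lemma contmin (f g : T -> R) :
  continuous f -> continuous g -> continuous (fun t => Num.min (f t) (g t)).
Proof.
by move=> cf cg t; apply: (@continuous_min R T f g); [exact: cf|exact: cg].
Qed.

Lemma contcst {Y : topologicalType} (y : Y) : continuous (fun _ : T => y).
Proof. exact: cst_continuous. Qed.

Lemma cont_glue {Y : topologicalType} (h : T -> R) (c : R) (a b : T -> Y) :
  continuous h -> continuous a -> continuous b ->
  (forall t, h t = c -> a t = b t) ->
  continuous (fun t => if h t <= c then a t else b t).
Proof.
move=> ch ca cb ab; apply/continuous_subspace_setT.
have -> : [set: T] = (h @^-1` [set r | r <= c]) `|` (h @^-1` [set r | c <= r]).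
  by apply/seteqP; split => // t _ /=; apply/orP; exact: le_total.
apply: withinU_continuous.
- by apply: closed_comp => [t _|]; [exact: ch|exact: closed_le].
- by apply: closed_comp => [t _|]; [exact: ch|exact: closed_ge].
- apply: (@subspace_eq_continuous _ _ _ a); last exact: continuous_subspaceT.
  move=> t /set_mem /= htc.
  by rewrite /from_subspace htc.
- apply: (@subspace_eq_continuous _ _ _ b); last exact: continuous_subspaceT.
  move=> t /set_mem /= hc; rewrite /from_subspace; case: ifP => // hc'.
  by rewrite ab //; apply/eqP; rewrite eq_le hc hc'.
Qed.

End continuity_lemmas.


Section continuous_interval.
Context {R : realType} {T Y : topologicalType}.
Local Notation I := (unit_interval R).

Lemma cont_ival (h : T -> I) : continuous h -> continuous (fun t => ival (h t)).
Proof. by move=> ch; apply: (contC ch); exact: continuous_ival. Qed.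

Lemma cont_toI (f : I -> Y) (h : T -> R) :
  continuous f -> continuous h -> continuous (fun t => f (toI (h t))).
Proof.
move=> cf ch; apply: (@contC _ I _ (fun t => toI (h t)) f) => //.
by apply: (contC ch); exact: continuous_toI.
Qed.

Lemma cont_toI2 (H : I * I -> Y) (h k : T -> R) :
  continuous H -> continuous h -> continuous k ->
  continuous (fun t => H (toI (h t), toI (k t))).
Proof.
move=> cH ch ck; apply: (@contC _ (I * I)%type _
  (fun t => (toI (h t), toI (k t))) H) => //.
by apply: contP; apply: (@contC _ _ _ _ (@toI R)) => //; exact: continuous_toI.
Qed.

End continuous_interval.

Section val_fst_snd.
Context {R : realType}.
Local Notation I := (unit_interval R).

Lemma cont_ival1 : continuous (fun p : I * I => ival p.1).
Proof. by apply: cont_ival => p; exact: cvg_fst. Qed.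

Lemma cont_ival2 : continuous (fun p : I * I => ival p.2).
Proof. by apply: cont_ival => p; exact: cvg_snd. Qed.

End val_fst_snd.

Section homotopy.
Context {R : realType} {T : topologicalType}.
Local Notation I := (unit_interval R).
Implicit Types x y z : T.

(* Homotopy relative to the end points; the second coordinate is the time. *)
Definition homotopic {x y} (f g : {path I from x to y}) : Prop :=
  exists H : I * I -> T, [/\ continuous H,
    forall s, H (s, zero) = f s,
    forall s, H (s, one) = g s,
    forall t, H (zero, t) = x &
    forall t, H (one, t) = y].

Section path_cat.
Context {x y z : T} (f : {path I from x to y}) (g : {path I from y to z}).

Let cat_fun (s : I) : T :=
  if ival s <= 1 / 2 then f (toI (2 * ival s)) else g (toI (2 * ival s - 1)).

Let cat_cts : continuous cat_fun.
Proof.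
apply: cont_glue.
- exact: continuous_ival.
- apply: cont_toI; first exact: cts_fun.
  by apply: contM; [exact: contcst|exact: continuous_ival].
- apply: cont_toI; first exact: cts_fun.
  apply: contB; last exact: contcst.
  by apply: contM; [exact: contcst|exact: continuous_ival].
- by move=> s ->; rewrite toI_ge1 ?toI_le0 ?path_one ?path_zero //; lra.
Qed.

Let cat_zero : cat_fun zero = x.
Proof. by rewrite /cat_fun ival_zero ifT ?toI_le0 ?path_zero //; lra. Qed.

Let cat_one : cat_fun one = z.
Proof. by rewrite /cat_fun ival_one ifF ?toI_ge1 ?path_one //; lra. Qed.

Definition path_cat : {path I from x to z} := mk_path cat_cts cat_zero cat_one.

Lemma path_catE s : path_cat s =
  if ival s <= 1 / 2 then f (toI (2 * ival s)) else g (toI (2 * ival s - 1)).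
Proof. by []. Qed.

End path_cat.

Section path_rev.
Context {x y : T} (f : {path I from x to y}).

Let rev_fun (s : I) : T := f (toI (1 - ival s)).

Let rev_cts : continuous rev_fun.
Proof.
apply: cont_toI; first exact: cts_fun.
by apply: contB; [exact: contcst|exact: continuous_ival].
Qed.

Let rev_zero : rev_fun zero = y.
Proof. by rewrite /rev_fun ival_zero toI_ge1 ?path_one //; lra. Qed.

Let rev_one : rev_fun one = x.
Proof. by rewrite /rev_fun ival_one toI_le0 ?path_zero //; lra. Qed.

Definition path_rev : {path I from y to x} := mk_path rev_cts rev_zero rev_one.

Lemma path_revE s : path_rev s = f (toI (1 - ival s)). Proof. by []. Qed.

End path_rev.

Definition path_cst x : {path I from x to x} := cst x.

Lemma path_revK x y (f : {path I from x to y}) : path_rev (path_rev f) = f.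
Proof.
apply/path_eqP => s; rewrite !path_revE ival_toI clampK.
  by rewrite subKr toI_ival.
by have := ival_ge0 s; have := ival_le1 s; lra.
Qed.

Lemma homotopic_refl x y (f : {path I from x to y}) : homotopic f f.
Proof.
exists (fun p => f p.1); split => //.
- apply: (@contC _ _ _ (fun p : I * I => p.1)); last exact: cts_fun.
  by move=> p; exact: cvg_fst.
- by move=> t; rewrite /= path_zero.
- by move=> t; rewrite /= path_one.
Qed.

Lemma homotopic_sym x y (f g : {path I from x to y}) :
  homotopic f g -> homotopic g f.
Proof.
case=> H [cH H0 H1 Hx Hy].
exists (fun p => H (toI (ival p.1), toI (1 - ival p.2))); split => [|s|s|t|t] /=.
- apply: cont_toI2 => //; first exact: cont_ival1.
  by apply: contB; [exact: contcst|exact: cont_ival2].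
- by rewrite ival_zero toI_ival (toI_ge1 (_ : 1 <= _)) ?H1 // subr0.
- by rewrite ival_one toI_ival (toI_le0 (_ : _ <= 0)) ?H0 // subrr.
- by rewrite toI_ival Hx.
- by rewrite toI_ival Hy.
Qed.

Lemma homotopic_trans x y (g f h : {path I from x to y}) :
  homotopic f g -> homotopic g h -> homotopic f h.
Proof.
case=> H [cH H0 H1 Hx Hy] [K [cK K0 K1 Kx Ky]].
exists (fun p => if ival p.2 <= 1 / 2 then H (toI (ival p.1), toI (2 * ival p.2))
                 else K (toI (ival p.1), toI (2 * ival p.2 - 1))).
have c2 : continuous (fun p : I * I => 2 * ival p.2 : R).
  by apply: contM; [exact: contcst|exact: cont_ival2].
split => [|s|s|t|t] /=.
- apply: cont_glue; first exact: cont_ival2.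
  + by apply: cont_toI2 => //; exact: cont_ival1.
  + apply: cont_toI2 => //; first exact: cont_ival1.
    by apply: contB => //; exact: contcst.
  + move=> [s t] /= ->; rewrite (toI_ge1 (_ : 1 <= 2 * (1 / 2))); last lra.
    by rewrite (toI_le0 (_ : 2 * (1 / 2) - 1 <= 0)) ?H1 ?K0 //; lra.
- rewrite ival_zero ifT; last lra.
  by rewrite (toI_le0 (_ : 2 * 0 <= 0)) ?toI_ival ?H0 //; lra.
- rewrite ival_one ifF; last lra.
  by rewrite (toI_ge1 (_ : 1 <= 2 * 1 - 1)) ?toI_ival ?K1 //; lra.
- by rewrite toI_ival Hx Kx if_same.
- by rewrite toI_ival Hy Ky if_same.
Qed.

Lemma homotopic_cat x y z (f f' : {path I from x to y})
    (g g' : {path I from y to z}) :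
  homotopic f f' -> homotopic g g' -> homotopic (path_cat f g) (path_cat f' g').
Proof.
case=> H [cH H0 H1 Hx Hy] [K [cK K0 K1 Kx Ky]].
exists (fun p => if ival p.1 <= 1 / 2 then H (toI (2 * ival p.1), toI (ival p.2))
                 else K (toI (2 * ival p.1 - 1), toI (ival p.2))).
have c2 : continuous (fun p : I * I => 2 * ival p.1 : R).
  by apply: contM; [exact: contcst|exact: cont_ival1].
split => [|s|s|t|t] /=.
- apply: cont_glue; first exact: cont_ival1.
  + by apply: cont_toI2 => //; exact: cont_ival2.
  + apply: cont_toI2 => //; last exact: cont_ival2.
    by apply: contB => //; exact: contcst.
  + move=> [s t] /= ->; rewrite (toI_ge1 (_ : 1 <= 2 * (1 / 2))); last lra.
    by rewrite (toI_le0 (_ : 2 * (1 / 2) - 1 <= 0)) ?Hy ?Kx //; lra.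
- by rewrite path_catE toI_ival H0 K0.
- by rewrite path_catE toI_ival H1 K1.
- rewrite ival_zero ifT; last lra.
  by rewrite (toI_le0 (_ : 2 * 0 <= 0)) ?Hx //; lra.
- rewrite ival_one ifF; last lra.
  by rewrite (toI_ge1 (_ : 1 <= 2 * 1 - 1)) ?Ky //; lra.
Qed.

Lemma homotopic_rev x y (f g : {path I from x to y}) :
  homotopic f g -> homotopic (path_rev f) (path_rev g).
Proof.
case=> H [cH H0 H1 Hx Hy].
exists (fun p => H (toI (1 - ival p.1), toI (ival p.2))); split => [|s|s|t|t] /=.
- apply: cont_toI2 => //; last exact: cont_ival2.
  by apply: contB; [exact: contcst|exact: cont_ival1].
- by rewrite toI_ival H0.
- by rewrite toI_ival H1.
- by rewrite ival_zero subr0 toI_ge1 // Hy.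
- by rewrite ival_one subrr toI_le0 // Hx.
Qed.

Lemma homotopic_reparam x y (f : I -> T) (phi psi : I -> R)
    (g h : {path I from x to y}) :
  continuous f -> continuous phi -> continuous psi ->
  phi zero = psi zero -> phi one = psi one ->
  (forall s, g s = f (toI (phi s))) -> (forall s, h s = f (toI (psi s))) ->
  homotopic g h.
Proof.
move=> cf cphi cpsi e0 e1 gE hE.
have c1 (k : I -> R) : continuous k -> continuous (fun p : I * I => k p.1).
  move=> ck; apply: (@contC _ _ _ (fun p : I * I => p.1)) => //.
  by move=> p; exact: cvg_fst.
exists (fun p => f (toI (phi p.1 + ival p.2 * (psi p.1 - phi p.1)))).
split => [|s|s|t|t] /=.
- apply: cont_toI => //; apply: contD; first exact: c1.
  apply: contM; first exact: cont_ival2.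
  by apply: contB; exact: c1.
- by rewrite ival_zero mul0r addr0 gE.
- by rewrite ival_one mul1r addrC subrK hE.
- by rewrite -e0 subrr mulr0 addr0 -gE path_zero.
- by rewrite -e1 subrr mulr0 addr0 -gE path_one.
Qed.


Lemma homotopic_catA x y z w (f : {path I from x to y})
    (g : {path I from y to z}) (h : {path I from z to w}) :
  homotopic (path_cat f (path_cat g h)) (path_cat (path_cat f g) h).
Proof.
apply: homotopic_sym.
pose phi (s : I) : R :=
  Num.min (Num.min (2 * ival s) (ival s + 1 / 4)) ((ival s + 1) / 2).
apply: (@homotopic_reparam _ _ (path_cat f (path_cat g h)) phi (@ival R)).
- exact: cts_fun.
- apply: contmin; last first.
    apply: contM; last exact: contcst.
    by apply: contD; [exact: continuous_ival|exact: contcst].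
  apply: contmin.
    by apply: contM; [exact: contcst|exact: continuous_ival].
  by apply: contD; [exact: continuous_ival|exact: contcst].
- exact: continuous_ival.
- by rewrite /phi ival_zero !minEle; do !case: ifP; lra.
- by rewrite /phi ival_one !minEle; do !case: ifP; lra.
- move=> s; have s0 := ival_ge0 s; have s1 := ival_le1 s.
  have [s14|s14] := leP (ival s) (1 / 4).
    have -> : phi s = 2 * ival s by rewrite /phi !minEle; do !case: ifP; lra.
    rewrite [LHS]path_catE ifT; last lra.
    rewrite [LHS]path_catE [RHS]path_catE !ival_toI clampK; last lra.
    by rewrite !ifT //; lra.
  have [s12|s12] := leP (ival s) (1 / 2).
    have -> : phi s = ival s + 1 / 4
      by rewrite /phi !minEle; do !case: ifP; lra.
    rewrite path_catE ifT // path_catE ival_toI clampK; last lra.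
    rewrite ifF; last lra.
    rewrite path_catE ival_toI clampK; last lra.
    rewrite ifF; last lra.
    rewrite path_catE ival_toI clampK; last lra.
    by rewrite ifT; [congr (g (toI _)); lra|lra].
  have -> : phi s = (ival s + 1) / 2
    by rewrite /phi !minEle; do !case: ifP; lra.
  rewrite path_catE ifF; last lra.
  rewrite path_catE ival_toI clampK; last lra.
  rewrite ifF; last lra.
  rewrite path_catE ival_toI clampK; last lra.
  by rewrite ifF; [congr (h (toI _)); lra|lra].
- by move=> s; rewrite toI_ival.
Qed.

Lemma homotopic_cat1p x y (f : {path I from x to y}) :
  homotopic (path_cat (path_cst x) f) f.
Proof.
apply: (@homotopic_reparam _ _ f (fun s => clamp (2 * ival s - 1)) (@ival R)).
- exact: cts_fun.
- apply: (@contC _ _ _ (fun s : I => 2 * ival s - 1) (@clamp R)).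
    apply: contB; last exact: contcst.
    by apply: contM; [exact: contcst|exact: continuous_ival].
  exact: continuous_clamp.
- exact: continuous_ival.
- by rewrite ival_zero clamp_le0 //; lra.
- by rewrite ival_one clamp_ge1 //; lra.
- move=> s; rewrite -ival_toI toI_ival path_catE; case: ifP => // s12.
  by rewrite (toI_le0 (_ : 2 * ival s - 1 <= 0)) ?path_zero //; lra.
- by move=> s; rewrite toI_ival.
Qed.

Lemma homotopic_catp1 x y (f : {path I from x to y}) :
  homotopic (path_cat f (path_cst y)) f.
Proof.
apply: (@homotopic_reparam _ _ f (fun s => clamp (2 * ival s)) (@ival R)).
- exact: cts_fun.
- apply: (@contC _ _ _ (fun s : I => 2 * ival s) (@clamp R)).
    by apply: contM; [exact: contcst|exact: continuous_ival].
  exact: continuous_clamp.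
- exact: continuous_ival.
- by rewrite ival_zero clamp_le0 //; lra.
- by rewrite ival_one clamp_ge1 //; lra.
- move=> s; rewrite -ival_toI toI_ival path_catE; case: ifP => // s12.
  by rewrite (toI_ge1 (_ : 1 <= 2 * ival s)) ?path_one //; lra.
- by move=> s; rewrite toI_ival.
Qed.

Lemma homotopic_cat_rev x y (f : {path I from x to y}) :
  homotopic (path_cat f (path_rev f)) (path_cst x).
Proof.
apply: (@homotopic_reparam _ _ f
  (fun s => Num.min (2 * ival s) (2 - 2 * ival s)) (cst 0)).
- exact: cts_fun.
- have c2 : continuous (fun s : I => 2 * ival s : R).
    by apply: contM; [exact: contcst|exact: continuous_ival].
  by apply: contmin => //; apply: contB => //; exact: contcst.
- exact: contcst.
- by rewrite ival_zero mulr0 subr0 min_l //; lra.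
- by rewrite ival_one mulr1 subrr min_r //; lra.
- move=> s; have s0 := ival_ge0 s; have s1 := ival_le1 s.
  rewrite path_catE; case: ifP => s12; first by rewrite min_l //; lra.
  rewrite path_revE ival_toI clampK; last lra.
  by rewrite min_r; [congr (f (toI _)); lra|lra].
- by move=> s; rewrite toI_le0 // path_zero.
Qed.

End homotopy.

Section fundamental_group.
Context {R : realType} {T : topologicalType}.
Local Notation I := (unit_interval R).

Section path_class.
Context (x : T).
Local Notation loop := {path I from x to x}.

Let homotopicb (f g : loop) : bool := `[< homotopic f g >].

Let homotopicb_refl : reflexive homotopicb.
Proof. by move=> f; apply/asboolP/homotopic_refl. Qed.

Let homotopicb_sym : symmetric homotopicb.
Proof. by move=> f g; apply/asboolP/asboolP; exact: homotopic_sym. Qed.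

Let homotopicb_trans : transitive homotopicb.
Proof.
move=> g f h /asboolP fg /asboolP gh; apply/asboolP.
exact: homotopic_trans fg gh.
Qed.

Canonical homotopic_equiv :=
  EquivRel homotopicb homotopicb_refl homotopicb_sym homotopicb_trans.

Definition pi1 : Type := {eq_quot homotopic_equiv}.
HB.instance Definition _ := Choice.on pi1.

Definition loop_class (f : loop) : pi1 := \pi_({eq_quot homotopic_equiv}) f.

Lemma loop_classP (f g : loop) : loop_class f = loop_class g <-> homotopic f g.
Proof.
by split => [/eqmodP/asboolP//|fg]; apply/eqmodP/asboolP.
Qed.

Lemma loop_class_ex (c : pi1) : exists f, c = loop_class f.
Proof.
by exists (repr (c : {eq_quot homotopic_equiv})); rewrite /loop_class reprK.
Qed.

Let rep (c : pi1) : loop := repr (c : {eq_quot homotopic_equiv}).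

Let repP (f : loop) : homotopic (rep (loop_class f)) f.
Proof. by apply/loop_classP; rewrite /loop_class /rep reprK. Qed.

Let mul (c d : pi1) : pi1 := loop_class (path_cat (rep c) (rep d)).
Let inv (c : pi1) : pi1 := loop_class (path_rev (rep c)).
Let one : pi1 := loop_class (path_cst x).

Let mulE (f g : loop) :
  mul (loop_class f) (loop_class g) = loop_class (path_cat f g).
Proof. by apply/loop_classP/homotopic_cat; exact: repP. Qed.

Let invE (f : loop) : inv (loop_class f) = loop_class (path_rev f).
Proof. by apply/loop_classP/homotopic_rev; exact: repP. Qed.

Let mulA : associative mul.
Proof.
move=> c d e; have [f ->] := loop_class_ex c; have [g ->] := loop_class_ex d.
have [h ->] := loop_class_ex e; rewrite !mulE.
exact/loop_classP/homotopic_catA.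
Qed.

Let mul1 : left_id one mul.
Proof.
move=> c; have [f ->] := loop_class_ex c; rewrite mulE.
exact/loop_classP/homotopic_cat1p.
Qed.

Let mulr1 : right_id one mul.
Proof.
move=> c; have [f ->] := loop_class_ex c; rewrite mulE.
exact/loop_classP/homotopic_catp1.
Qed.

Let mulrV : right_inverse one inv mul.
Proof.
move=> c; have [f ->] := loop_class_ex c; rewrite invE mulE.
exact/loop_classP/homotopic_cat_rev.
Qed.

Let mulV : left_inverse one inv mul.
Proof.
move=> c; have [f ->] := loop_class_ex c; rewrite invE mulE.
rewrite -[f in path_cat _ f]path_revK.
exact/loop_classP/homotopic_cat_rev.
Qed.

HB.instance Definition _ := isGroup.Build pi1 mulA mul1 mulr1 mulV mulrV.

Lemma loop_classM (f g : loop) :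
  (loop_class f * loop_class g)%g = loop_class (path_cat f g).
Proof. exact: mulE. Qed.

Lemma loop_classV (f : loop) :
  ((loop_class f)^-1)%g = loop_class (path_rev f).
Proof. exact: invE. Qed.

Lemma loop_class1 : loop_class (path_cst x) = 1%g.
Proof. by []. Qed.

End path_class.
End fundamental_group.

Arguments pi1 R {T} x.

Section induced_map.
Context {R : realType} {T U : topologicalType} (f : continuousType T U) (x : T).
Local Notation I := (unit_interval R).

Definition path_map y z (g : {path I from y to z}) :
  {path I from f y to f z} := f \o g.

Definition pi1_map (c : pi1 R x) : pi1 R (f x) :=
  loop_class (path_map (repr (c : {eq_quot (@homotopic_equiv R T x)}))).

Lemma homotopic_map y z (g h : {path I from y to z}) :
  homotopic g h -> homotopic (path_map g) (path_map h).
Proof.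
case=> H [cH H0 H1 Hx Hy]; exists (fun p => f (H p)); split.
- by apply: (contC cH); exact: cts_fun.
- by move=> s; rewrite H0.
- by move=> s; rewrite H1.
- by move=> t; rewrite Hx.
- by move=> t; rewrite Hy.
Qed.

Lemma pi1_mapE (g : {path I from x to x}) :
  pi1_map (loop_class g) = loop_class (path_map g).
Proof.
apply/loop_classP/homotopic_map/loop_classP.
by rewrite /loop_class reprK.
Qed.

Let pi1_mapF : {morph pi1_map : c d / (c / d)%g}.
Proof.
move=> c d; have [g ->] := loop_class_ex c; have [h ->] := loop_class_ex d.
rewrite loop_classV loop_classM !pi1_mapE loop_classV loop_classM.
congr loop_class; apply/path_eqP => s.
by rewrite /path_map /= !path_catE (fun_if f).
Qed.

HB.instance Definition _ :=
  isGroupMorphism.Build (pi1 R x) (pi1 R (f x)) pi1_map pi1_mapF.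

End induced_map.

Section small_generated.
Variable R : realType.
Local Notation I := (unit_interval R).

Definition subgroup (G : groupType) (H : set G) : Prop :=
  group_closed (mem H).

Section small_subgroups.
Context {Y : topologicalType} (y : Y).

Definition small_loop (b : {path I from y to y}) : Prop :=
  forall V : set Y, open_nbhs y V ->
    exists2 b' : {path I from y to y}, range b' `<=` V & homotopic b b'.

Definition pi1_small : set (pi1 R y) := [set loop_class b | b in small_loop].

End small_subgroups.

Arguments pi1_small {Y} y.

(* [smallest] is the intersection of all subgroups containing the generators. *)
Definition pi1_sg {Y : topologicalType} (y : Y) : set (pi1 R y) :=
  smallest (@subgroup (pi1 R y))
    [set c | exists (z : Y) (a : {path I from y to z}) (b : {path I from z to z}),
      pi1_small z (loop_class b) /\
      c = loop_class (path_cat (path_cat a b) (path_rev a))].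

Arguments pi1_sg {Y} y.

Definition small_generated (Y : topologicalType) : Prop :=
  forall y : Y, [set: pi1 R y] = pi1_sg y.

(* As with the library's [connected], the empty set is path connected. *)
Definition path_connected {Y : topologicalType} (A : set Y) : Prop :=
  forall x y, A x -> A y ->
    exists g : {path I from x to y in Y}, range g `<=` A.

Definition locally_path_connected (Y : topologicalType) : Prop :=
  forall (x : Y) (U : set Y), open_nbhs x U ->
    exists V : set Y, [/\ open_nbhs x V, V `<=` U & path_connected V].

Definition incl {Y : topologicalType} (U : set Y) : U -> Y := val.

HB.instance Definition _ {Y : topologicalType} (U : set Y) :=
  isContinuous.Build U Y (@incl Y U) (@initial_continuous _ _ _).

Definition semi_locally_small_generated (X : topologicalType) : Prop :=
  forall x : X, exists (U : set X) (Ux : x \in U),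
    open U /\ range (@pi1_map R _ _ (@incl X U) (SigSub Ux)) `<=` pi1_sg x.

End small_generated.

Arguments pi1_small R {Y} y.
Arguments pi1_sg R {Y} y.

Section coverings.

(* [f] restricts to a homeomorphism from [V] onto [U]; only the values of [g] on
   [U] matter. *)
Definition homeomorphism_on {Y X : topologicalType} (V : set Y) (U : set X)
    (f : Y -> X) : Prop :=
  [/\ set_bij V U f, {within V, continuous f} &
    exists g : X -> Y, [/\ {within U, continuous g}, g @` U `<=` V &
      {in V, cancel f g}]].

(* [F] is the set of sheets over [U]. *)
Definition evenly_covered {Y X : topologicalType} (p : Y -> X) (U : set X) :
    Prop :=
  exists F : set (set Y), [/\ p @^-1` U = \bigcup_(V in F) V,
    trivIset F id &
    forall V, F V -> open V /\ homeomorphism_on V U p].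

Definition covering {Y X : topologicalType} (p : Y -> X) : Prop :=
  [/\ continuous p, range p = [set: X] &
    forall x, exists2 U, open_nbhs x U & evenly_covered p U].

Variable R : realType.

Definition small_generated_covering {Xt X : topologicalType} (p : Xt -> X) :
    Prop :=
  [/\ covering p, path_connected R [set: Xt] & small_generated R Xt].

(* The base points [x] and [xt] are arbitrary. *)
Definition universal_covering {Xt X : topologicalType} (p : Xt -> X) : Prop :=
  [/\ covering p, path_connected R [set: Xt] &
    forall (x : X) (xt : Xt), p xt = x ->
    forall (Yt : topologicalType) (q : Yt -> X) (yt : Yt),
      covering q -> path_connected R [set: Yt] -> q yt = x ->
      exists! r : Xt -> Yt, [/\ covering r, r xt = yt & q \o r = p]].

End coverings.

(* Main.v *)
Require Import Defs.
From HB Require Import structures.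
From mathcomp Require Import all_boot all_order all_algebra generic_quotient.
From mathcomp Require Import all_classical reals topology normedtype homotopy.
From mathcomp Require Import ring lra.
From Corelib Require Import RelationClasses.
From Corelib Require Setoid Morphisms.

Set Implicit Arguments.
Unset Strict Implicit.
Unset Printing Implicit Defensive.

Import Order.TTheory GRing.Theory Num.Theory.
Import numFieldNormedType.Exports.

Local Open Scope classical_set_scope.
Local Open Scope ring_scope.
Local Open Scope quotient_scope.

(* Covering maps have unique lifts of paths and of homotopies.  A small loop is
   homotopic into an evenly covered set, so it lifts to a closed loop in every
   covering; hence so does every element of [pi1_sg].

   If [p : E -> X] is a small generated covering, a loop inside an evenly covered
   open set lifts to a loop of [E], whose class lies in [pi1_sg E], and [p] maps
   [pi1_sg E] into [pi1_sg X]; thus [X] is semi-locally small generated.  For any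
   other covering [q], all loops of [E] are products of conjugates of small ones,
   so their images in [X] have closed [q]-lifts and the lifting criterion
   yields [r] with [q \o r = p]; as [X] is locally path connected, [r] is itself a
   covering.

   Conversely, take the paths issued from [x0] modulo [f ~ g] iff [f g^-1] is in
   [pi1_sg X x0].  Semi-local small generation says that the endpoint map is
   injective on the basic open sets over small path connected sets, so it is a
   covering.  A loop of this space projects to an element of [pi1_sg X], i.e. to a
   product of conjugates of small loops, and small loops lift to small loops, so
   it lies in [pi1_sg] of the cover. *)

(** * General topology: local criteria for openness and continuity *)

Section topology_complements.
Context {T : topologicalType}.

Lemma open_locally (A : set T) :
  (forall t, A t -> exists2 B, open_nbhs t B & B `<=` A) -> open A.
Proof.
move=> h; rewrite openE => t /h[B Bt BA].
by apply: filterS BA _; exact: open_nbhs_nbhs.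
Qed.

Lemma clopen_connectedT (A : set T) :
  connected [set: T] -> open A -> open (~` A) -> A !=set0 -> A = setT.
Proof.
move=> cT oA oC A0; apply: cT => //; exists A; rewrite ?setTI //.
by rewrite -[A]setCK; exact: open_closedC.
Qed.

Lemma cvg_open {Y : topologicalType} (f : T -> Y) (t : T) :
  (forall V, open_nbhs (f t) V -> exists2 U, open_nbhs t U & U `<=` f @^-1` V) ->
  {for t, continuous f}.
Proof.
move=> h A; rewrite /= !nbhsE => -[V /h[U Ut UV] VA].
by exists U => //; apply: subset_trans UV _ => z /VA.
Qed.

Lemma open_nbhs_preimage {Y : topologicalType} (f : T -> Y) (t : T) (V : set Y) :
  {for t, continuous f} -> open_nbhs (f t) V ->
  exists2 U, open_nbhs t U & U `<=` f @^-1` V.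
Proof.
by move=> /(_ V) + /open_nbhs_nbhs fV => /(_ fV); rewrite /= nbhsE.
Qed.

End topology_complements.

(** * Sheets of a covering and uniqueness of lifts *)

Section sheets.
Context {E X : topologicalType}.
Implicit Types (p : E -> X) (U : set X) (V : set E) (g : X -> E).

(** The inverse [g] of [p] on the sheet is a total function with constraints on [U] only; its
    continuity is stated in [X] at points of [U], so no subspace topology appears. *)
Record sheet p U V g : Prop := Sheet {
  sheet_open : open V;
  sheet_sub : forall v, V v -> U (p v);
  sheet_mem : forall u, U u -> V (g u);
  sheet_sec : forall u, U u -> p (g u) = u;
  sheet_ret : forall v, V v -> g (p v) = v;
  sheet_cts : forall u, U u -> {for u, continuous g} }.

Lemma homeomorphism_on_sheet p U V :
  open U -> open V -> homeomorphism_on V U p -> exists g, sheet p U V g.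
Proof.
move=> oU oV [[pVU _ pS] _ [g [gc gV gK]]]; exists g; split => //.
- by move=> u Uu; apply: gV; exists u.
- by move=> u /pS[v Vv <-]; rewrite gK // inE.
- by move=> v Vv; rewrite gK // inE.
- move=> u Uu; have : {in U, continuous g} by rewrite -continuous_open_subspace.
  by apply; rewrite inE.
Qed.

Lemma sheet_homeomorphism_on p U V g :
  {in V, continuous p} -> open U -> sheet p U V g -> homeomorphism_on V U p.
Proof.
move=> cp oU S; split.
- split => [v /(sheet_sub S)//|v v' /set_mem Vv /set_mem Vv' vv'|u Uu].
    by rewrite -(sheet_ret S Vv) vv' (sheet_ret S Vv').
  by exists (g u); [exact: (sheet_mem S)|exact: (sheet_sec S)].
- by rewrite continuous_open_subspace //; exact: (sheet_open S).
- exists g; split.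
  + rewrite continuous_open_subspace // => u /set_mem; exact: (sheet_cts S).
  + by move=> _ [u Uu <-]; exact: (sheet_mem S).
  + by move=> v /set_mem; exact: (sheet_ret S).
Qed.

(** Each sheet [V] is cut down to [V] intersected with the preimage of [U'], with the same inverse.
    This allows passing to path connected evenly covered sets. *)
Lemma evenly_coveredW p U U' :
  continuous p -> open U -> open U' -> U' `<=` U ->
  evenly_covered p U -> evenly_covered p U'.
Proof.
move=> cp oU oU' sU [F [FE Ftriv Fs]].
exists [set V `&` p @^-1` U' | V in F]; split.
- apply/seteqP; split => e /=.
    move=> U'e; have : (p @^-1` U) e by exact: sU.
    by rewrite FE => -[V FV Ve]; exists (V `&` p @^-1` U') => //; exists V.
  by move=> [_ [V FV <-] []].
- move=> _ _ [V FV <-] [V' FV' <-] [e [[Ve _] [V'e _]]].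
  by rewrite (Ftriv V V' FV FV') //; exists e.
- move=> _ [V FV <-]; have [oV hV] := Fs _ FV.
  have [g S] := homeomorphism_on_sheet oU oV hV.
  have oV' : open (V `&` p @^-1` U').
    by apply: openI => //; apply: open_comp => // e _; exact: cp.
  split => //; apply: (@sheet_homeomorphism_on _ _ _ g) => [e _||]; first exact: cp.
    by [].
  split => //.
  + by move=> v [].
  + by move=> u U'u; have Uu := sU _ U'u; split;
      [exact: (sheet_mem S)|rewrite /= (sheet_sec S)].
  + by move=> u /sU; exact: (sheet_sec S).
  + by move=> v [/(sheet_ret S)].
  + by move=> u /sU; exact: (sheet_cts S).
Qed.

(** The last clause holds because distinct sheets are disjoint; it separates two points of one
    fibre, as uniqueness of lifts requires. *)
Lemma evenly_covered_sheet p U e :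
  open U -> evenly_covered p U -> U (p e) ->
  exists V g, [/\ sheet p U V g, V e &
    forall e', U (p e') -> ~ V e' ->
      exists V', open_nbhs e' V' /\ V `&` V' = set0].
Proof.
move=> oU [F [FE Ftriv Fs]] Upe.
have inF e' : U (p e') -> exists2 V, F V & V e'.
  by move=> Ue'; have : (p @^-1` U) e' by []; rewrite FE => -[V]; exists V.
have [V FV Ve] := inF e Upe; have [oV hV] := Fs _ FV.
have [g S] := homeomorphism_on_sheet oU oV hV; exists V, g; split => // e' Ue' nVe'.
have [V' FV' V'e'] := inF e' Ue'; have [oV' _] := Fs _ FV'.
exists V'; split => //; apply: contrapT => /eqP/set0P VV'.
by apply: nVe'; rewrite (Ftriv _ _ FV FV' VV').
Qed.

Lemma covering_continuous p : covering p -> continuous p.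
Proof. by case. Qed.

Lemma covering_sheet p e : covering p ->
  exists U V g, [/\ open_nbhs (p e) U, sheet p U V g & V e].
Proof.
case=> _ _ /(_ (p e))[U [oU Ue] /evenly_covered_sheet ec].
by have [V [g [S Ve _]]] := ec e oU Ue; exists U, V, g.
Qed.

(** The agreement set is clopen: where the lifts agree they stay in one sheet, on which [p] is
    injective; where they differ they stay in disjoint open sets. *)
Lemma lift_unique p (T : topologicalType) (k k' : T -> E) (t0 : T) :
  covering p -> connected [set: T] -> continuous k -> continuous k' ->
  (forall t, p (k t) = p (k' t)) -> k t0 = k' t0 -> k =1 k'.
Proof.
move=> cp cT ck ck' pk e0.
suff A : [set t | k t = k' t] = setT.
  by move=> t; have : [set: T] t by []; rewrite -A.
apply: clopen_connectedT => //; last by exists t0.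
- apply: open_locally => t /= kt.
  have [U [V [g [Ut S Vt]]]] := covering_sheet (k t) cp.
  have [B Bt BV] := open_nbhs_preimage (ck t) (conj (sheet_open S) Vt).
  have V't : V (k' t) by rewrite -kt.
  have [B' B't B'V] := open_nbhs_preimage (ck' t) (conj (sheet_open S) V't).
  exists (B `&` B'); first exact: open_nbhsI.
  move=> s [/BV Vs /B'V V's] /=.
  by rewrite -(sheet_ret S Vs) pk (sheet_ret S V's).
- apply: open_locally => t /= kt.
  have [_ _ /(_ (p (k t)))[U [oU Ut] ec]] := cp.
  have [V [g [S Vt sep]]] := evenly_covered_sheet oU ec Ut.
  have Ut' : U (p (k' t)) by rewrite -pk.
  have [|V' [V't VV']] := sep (k' t) Ut'.
    by move=> V't; apply: kt; rewrite -(sheet_ret S Vt) pk (sheet_ret S V't).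
  have [B Bt BV] := open_nbhs_preimage (ck t) (conj (sheet_open S) Vt).
  have [B' B't B'V] := open_nbhs_preimage (ck' t) V't.
  exists (B `&` B'); first exact: open_nbhsI.
  move=> s [/BV Vs /B'V V's] kk /=.
  have : (V `&` V') (k s) by split => //; rewrite kk.
  by rewrite VV'.
Qed.

End sheets.

(** * Compactness of intervals as an induction principle *)

Section interval_induction.
Variable R : realType.

(** Plays the part of a Lebesgue number argument: the supremum of the [x] with [P a x] cannot lie
    below [b], since the local hypothesis carries [P] past it. *)
Lemma interval_ind (P : R -> R -> Prop) :
  (forall a b c, a <= b -> b <= c -> P a b -> P b c -> P a c) ->
  (forall x, exists2 e : R, 0 < e &
    forall a b, x - e < a -> a <= b -> b < x + e -> P a b) ->
  forall a b, a <= b -> P a b.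
Proof.
move=> Ptrans Ploc a b ab; pose S := [set x | a <= x <= b /\ P a x].
have Sa : S a.
  split; first by rewrite lexx.
  by have [e e0] := Ploc a; apply; lra.
have Sb : ubound S b by move=> x [/andP[]].
have Ssup : has_sup S by split; [exists a|exists b].
have sleb : sup S <= b by apply: ge_sup => //; exists a.
have ales : a <= sup S by apply: sup_upper_bound.
have [e e0 Pe] := Ploc (sup S).
have [x [axb Pax] sx] := sup_adherent e0 Ssup.
have xs : x <= sup S by apply: sup_upper_bound.
have [sb|bs] := ltP (sup S) b; last first.
  have -> : b = sup S by apply/eqP; rewrite eq_le bs.
  by apply: Ptrans Pax (Pe _ _ _ _ _); lra.
(* A point beyond the supremum, still in [[a, b]] and within the radius [e], which contradicts the
   upper bound. *)
pose y := Num.min b (sup S + e / 2).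
have sy : sup S < y by rewrite /y lt_min sb /=; lra.
have ye : y < sup S + e by rewrite /y minEle; case: ifP; lra.
have yb : y <= b by rewrite /y ge_min lexx.
suff : S y by move/(sup_upper_bound Ssup); rewrite leNgt sy.
split; first by apply/andP; split => //; lra.
by apply: Ptrans Pax (Pe _ _ _ _ _); lra.
Qed.

Lemma connected_realT : connected [set: R].
Proof. by apply/connected_intervalP. Qed.

Lemma connected_unit_interval : connected [set: unit_interval R].
Proof.
have <- : @toI R @` [set: R] = setT.
  by apply/seteqP; split => // s _; exists (ival s); rewrite ?toI_ival.
apply: connected_continuous_connected; first exact: connected_realT.
by apply: continuous_subspaceT; exact: continuous_toI.
Qed.

End interval_induction.

(** * Lifting maps defined on rectangles *)

Section rectangle_lifting.
Context {R : realType} {E X : topologicalType}.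
Variables (p : E -> X).
Hypothesis cov : covering p.

Definition trunc (a b t : R) : R := Num.min b (Num.max a t).

Lemma trunc_id (a b t : R) : a <= t -> t <= b -> trunc a b t = t.
Proof. by move=> at_ tb; rewrite /trunc max_r // min_r. Qed.

Lemma trunc_itv (a b t : R) : a <= b -> a <= trunc a b t <= b.
Proof. by move=> ab; rewrite /trunc le_min ab le_max lexx ge_min lexx. Qed.

Lemma continuous_trunc (T : topologicalType) (a b : R) (f : T -> R) :
  continuous f -> continuous (fun t => trunc a b (f t)).
Proof.
move=> cf; apply: contmin; first exact: contcst.
move=> t; apply: (@continuous_max R T (cst a) f); last exact: cf.
exact: cst_continuous.
Qed.

(* Every lift of the lower left corner of [a, b] x [c, d] extends to a lift of
   the map obtained by retracting the plane onto this rectangle; working with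
   total functions makes gluing easy. *)
Definition lifts_rect (h : R * R -> X) (a b c d : R) : Prop :=
  forall e, p e = h (a, c) -> exists k : R * R -> E,
    [/\ continuous k, forall z, p (k z) = h (trunc a b z.1, trunc c d z.2) &
        k (a, c) = e].

Lemma continuous_swap (T U : topologicalType) :
  continuous (fun z : T * U => (z.2, z.1)).
Proof. by apply: contP => z; [exact: cvg_snd|exact: cvg_fst]. Qed.

Lemma lifts_rectC (h : R * R -> X) a b c d :
  lifts_rect h a b c d -> lifts_rect (fun z => h (z.2, z.1)) c d a b.
Proof.
move=> L e /= /L[k [ck pk ke]]; exists (fun z => k (z.2, z.1)); split => //.
by apply: (contC _ ck); exact: continuous_swap.
Qed.

(** The second lift starts where the first one reaches the corner [(b, c)]; unique lifting along the
    common edge makes the two agree there, so they glue. *)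
Lemma lifts_rect_cat (h : R * R -> X) a b b' c d :
  a <= b -> b <= b' -> c <= d ->
  lifts_rect h a b c d -> lifts_rect h b b' c d -> lifts_rect h a b' c d.
Proof.
move=> ab bb' cd L L' e /L[k [ck pk ke]].
have [|k' [ck' pk' ke']] := L' (k (b, c)).
  by rewrite pk /= !trunc_id.
have kk' t : k (b, t) = k' (b, t).
  apply: (@lift_unique _ _ p R (fun t => k (b, t)) (fun t => k' (b, t)) c) => //.
  - exact: connected_realT.
  - by apply: contC ck; apply: contP => [|z]; [exact: contcst|exact: cvg_id].
  - by apply: contC ck'; apply: contP => [|z]; [exact: contcst|exact: cvg_id].
  - by move=> s; rewrite pk pk' /= (trunc_id ab (lexx b)) (trunc_id (lexx b) bb').
exists (fun z => if z.1 <= b then k z else k' z); split.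
- apply: cont_glue => //; first by move=> z; exact: cvg_fst.
  by move=> [s t] /= ->.
- move=> [s t] /=; case: ifPn => sb; rewrite ?pk ?pk' /=; congr (h (_, _)).
    have [sa|sa] := leP s a; last by rewrite !trunc_id //; lra.
    by rewrite /trunc !max_l // !min_r //; lra.
  move: sb; rewrite -ltNge => sb; have [sb'|sb'] := leP s b'.
    by rewrite !trunc_id //; lra.
  by rewrite /trunc !max_r ?min_l //; lra.
- by rewrite /= ab.
Qed.

(** A small rectangle is mapped into an evenly covered set, where composing with the inverse [g] of
    a sheet gives the lift. *)
Lemma lifts_rect_loc (h : R * R -> X) s t : continuous h ->
  exists2 e : R, 0 < e & forall a b c d, s - e < a -> a <= b -> b < s + e ->
    t - e < c -> c <= d -> d < t + e -> lifts_rect h a b c d.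
Proof.
move=> ch; have [_ _ /(_ (h (s, t)))[U [oU Ust] ec]] := cov.
have /= : nbhs (s, t) (h @^-1` U) by apply: ch; exact: open_nbhs_nbhs.
move=> [[A B] /= [/nbhs_ballP[e /= e0 eA] /nbhs_ballP[e' /= e'0 eB]] AB].
have hU s' t' : `|s - s'| < e -> `|t - t'| < e' -> U (h (s', t')).
  by move=> ss' tt'; apply: (AB (s', t')); split => /=; [apply: eA|apply: eB].
exists (Num.min e e'); first by rewrite lt_min e0.
move=> a b c d sa ab bs tc cd dt.
have me : Num.min e e' <= e by rewrite ge_min lexx.
have me' : Num.min e e' <= e' by rewrite ge_min lexx orbT.
have hUr x y : U (h (trunc a b x, trunc c d y)).
  have := trunc_itv x ab; have := trunc_itv y cd => /andP[c1 c2] /andP[a1 a2].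
  by apply: hU; rewrite ltr_norml; apply/andP; split; lra.
move=> x px; have Ux : U (p x).
  by rewrite px -(@trunc_id a b a) // -(@trunc_id c d c) //; exact: hUr.
have [V [g [S Vx _]]] := evenly_covered_sheet oU ec Ux.
exists (fun z => g (h (trunc a b z.1, trunc c d z.2))); split.
- have ctr : continuous (fun z : R * R => h (trunc a b z.1, trunc c d z.2)).
    apply: (@contC _ _ _
      (fun z : R * R => (trunc a b z.1, trunc c d z.2)) h) => //.
    by apply: contP; apply: continuous_trunc => w; [exact: cvg_fst|exact: cvg_snd].
  move=> z; apply: (@continuous_comp _ _ _
    (fun z : R * R => h (trunc a b z.1, trunc c d z.2)) g); first exact: ctr.
  by apply: (sheet_cts S); exact: hUr.
- by move=> z; rewrite (sheet_sec S).
- by rewrite /= !trunc_id // -px (sheet_ret S).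
Qed.

Lemma lifts_rectT (h : R * R -> X) a b c d :
  continuous h -> a <= b -> c <= d -> lifts_rect h a b c d.
Proof.
move=> ch ab; apply: (interval_ind (P := fun c d => lifts_rect h a b c d)).
  move=> c1 c2 c3 c12 c23 L L'.
  apply: (@lifts_rectC (fun z => h (z.2, z.1))).
  by apply: (lifts_rect_cat c12 c23 ab); exact: lifts_rectC.
move=> t; move: a b ab.
(* A tube argument: the height [e] of the strip around [t] belongs to the inductive predicate, and
   the smaller of two heights serves for a concatenation. *)
apply: (interval_ind (P := fun a b => exists2 e : R, 0 < e & forall c d : R,
  t - e < c -> c <= d -> d < t + e -> lifts_rect h a b c d)) => //.
  move=> a1 a2 a3 a12 a23 [e e0 Le] [e' e'0 Le'].
  exists (Num.min e e'); first by rewrite lt_min e0.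
  have me : Num.min e e' <= e by rewrite ge_min lexx.
  have me' : Num.min e e' <= e' by rewrite ge_min lexx orbT.
  move=> c1 d1 c1t cd1 d1t; apply: (lifts_rect_cat a12 a23 cd1).
    by apply: Le => //; lra.
  by apply: Le' => //; lra.
move=> s; have [e e0 He] := lifts_rect_loc s t ch.
by exists e => // a1 b1 *; exists e => // *; exact: He.
Qed.

End rectangle_lifting.

(** * Lifting squares and paths *)

Section path_lifting.
Context {R : realType} {E X : topologicalType}.
Local Notation I := (unit_interval R).
Variables (p : E -> X).
Hypothesis cov : covering p.

(** Truncation by [toI] extends [H] to the plane, where rectangle lifting applies. *)
Lemma square_lift (H : I * I -> X) (e : E) :
  continuous H -> p e = H (zero, zero) ->
  exists K : I * I -> E, [/\ continuous K, p \o K =1 H & K (zero, zero) = e].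
Proof.
move=> cH pe.
have ch : continuous (fun z : R * R => H (toI z.1, toI z.2)).
  by apply: cont_toI2 => // z; [exact: cvg_fst|exact: cvg_snd].
have [|k [ck pk ke]] := @lifts_rectT R _ _ _ cov _ 0 1 0 1 ch ler01 ler01 e.
  by rewrite /= !toI_le0.
exists (fun z => k (ival z.1, ival z.2)); split.
- by apply: contC ck; apply: contP; [exact: cont_ival1|exact: cont_ival2].
- move=> [s t]; rewrite /= pk /= !trunc_id ?ival_ge0 ?ival_le1 //.
  by rewrite !toI_ival.
- by rewrite !ival_zero.
Qed.

Lemma path_lift x y (f : {path I from x to y}) (e : E) :
  p e = x -> exists e1 (ft : {path I from e to e1}), p \o ft =1 f.
Proof.
(* The path is lifted as a square that is constant in time. *)
move=> pe; have [||K [cK pK K0]] := @square_lift (fun z => f z.1) e.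
- by apply: (@contC _ _ _ (fun z : I * I => z.1)); [move=> z; exact: cvg_fst|exact: cts_fun].
- by rewrite path_zero.
have cKs : continuous (fun s : I => K (s, zero)).
  by apply: contC cK; apply: contP => [z|]; [exact: cvg_id|exact: contcst].
exists (K (one, zero)), (mk_path cKs K0 erefl) => s.
by rewrite /= /mk_path; exact: pK.
Qed.

Lemma path_lift_unique (k k' : I -> E) : continuous k -> continuous k' ->
  k zero = k' zero -> (forall s, p (k s) = p (k' s)) -> k =1 k'.
Proof.
move=> ck ck' e pk.
exact: (lift_unique cov (@connected_unit_interval R) ck ck' pk e).
Qed.

End path_lifting.

(* Rewriting up to homotopy and the groupoid laws of paths *)
#[export] Hint Resolve homotopic_refl : core.

#[export] Instance homotopic_equivalence (R : realType) (T : topologicalType)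
  (x y : T) : Equivalence (@homotopic R T x y).
Proof.
split; first exact: homotopic_refl.
  exact: homotopic_sym.
by move=> f g h; exact: homotopic_trans.
Qed.

#[export] Instance path_cat_homotopic (R : realType) (T : topologicalType)
  (x y z : T) : Morphisms.Proper
    (Morphisms.respectful (@homotopic R T x y)
      (Morphisms.respectful (@homotopic R T y z) (@homotopic R T x z)))
    (@path_cat R T x y z).
Proof. by move=> f f' ff' g g' gg'; exact: homotopic_cat. Qed.

#[export] Instance path_rev_homotopic (R : realType) (T : topologicalType)
  (x y : T) : Morphisms.Proper
    (Morphisms.respectful (@homotopic R T x y) (@homotopic R T y x))
    (@path_rev R T x y).
Proof. by move=> f f' ff'; exact: homotopic_rev. Qed.

Section path_groupoid.
Context {R : realType} {T : topologicalType}.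
Local Notation I := (unit_interval R).
Implicit Types x y z : T.

Lemma homotopic_eq x y (f g : {path I from x to y}) : f =1 g -> homotopic f g.
Proof. by move=> /path_eqP ->; exact: homotopic_refl. Qed.

Lemma homotopic_rev_cat x y (f : {path I from x to y}) :
  homotopic (path_cat (path_rev f) f) (path_cst y).
Proof. by have := homotopic_cat_rev (path_rev f); rewrite path_revK. Qed.

Lemma homotopic_catK x y z (f : {path I from x to y}) (g : {path I from y to z}) :
  homotopic (path_cat (path_cat f g) (path_rev g)) f.
Proof. by rewrite -homotopic_catA homotopic_cat_rev homotopic_catp1. Qed.

Lemma homotopic_catVK x y z (f : {path I from x to y}) (g : {path I from z to y}) :
  homotopic (path_cat (path_cat f (path_rev g)) g) f.
Proof. by have := homotopic_catK f (path_rev g); rewrite path_revK. Qed.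

Lemma homotopic_catI x y z (f f' : {path I from x to y}) (g : {path I from y to z}) :
  homotopic (path_cat f g) (path_cat f' g) -> homotopic f f'.
Proof. by move=> fg; rewrite -(homotopic_catK f g) fg homotopic_catK. Qed.

(** Both sides become constant after appending [path_cat f g], which can be cancelled. *)
Lemma homotopic_revM x y z (f : {path I from x to y}) (g : {path I from y to z}) :
  homotopic (path_rev (path_cat f g)) (path_cat (path_rev g) (path_rev f)).
Proof.
apply: (@homotopic_catI _ _ _ _ _ (path_cat f g)).
by rewrite homotopic_rev_cat homotopic_catA homotopic_catVK homotopic_rev_cat.
Qed.

Lemma homotopic_rev_cst x :
  homotopic (path_rev (path_cst x)) (path_cst x : {path I from x to x}).
Proof. exact: homotopic_eq. Qed.

(** Stated pointwise, since the end points [h x] and [u] are equal but need not be convertible. *)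
Lemma path_cat_map (U : topologicalType) (h : T -> U) x y z
    (f : {path I from x to y}) (g : {path I from y to z}) u v w
    (f' : {path I from u to v}) (g' : {path I from v to w}) :
  h \o f =1 f' -> h \o g =1 g' -> h \o path_cat f g =1 path_cat f' g'.
Proof.
by move=> ff' gg' s; rewrite /= !path_catE (fun_if h) -(ff' (toI _)) -(gg' (toI _)).
Qed.

Lemma path_rev_map (U : topologicalType) (h : T -> U) x y u v
    (f : {path I from x to y}) (f' : {path I from u to v}) :
  h \o f =1 f' -> h \o path_rev f =1 path_rev f'.
Proof. by move=> ff' s; rewrite /= !path_revE -(ff' (toI _)). Qed.

End path_groupoid.

(** * The SG subgroup: induction, conjugation and functoriality *)

Section small_generated_subgroup.
Context {R : realType}.
Local Notation I := (unit_interval R).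

Lemma subgroupP (G : groupType) (H : set G) :
  subgroup H <-> H 1%g /\ forall c d, H c -> H d -> H (c / d)%g.
Proof.
rewrite /subgroup /group_closed; split => [[/set_mem H1 HF]|[H1 HF]].
  by split => // c d Hc Hd; apply/set_mem/HF; exact/mem_set.
by split; [exact/mem_set|move=> c d /set_mem Hc /set_mem Hd; exact/mem_set/HF].
Qed.

Section space.
Context {Y : topologicalType}.
Implicit Types x y z : Y.

(** The generators are given by classes in [pi1_small]; replacing [b] by a small representative lets
    the induction assume that the loop itself is small. *)
Lemma pi1_sg_ind y (P : set (pi1 R y)) : P 1%g ->
  (forall c d, P c -> P d -> P (c / d)%g) ->
  (forall z (a : {path I from y to z}) (b : {path I from z to z}),
    small_loop b -> P (loop_class (path_cat (path_cat a b) (path_rev a)))) ->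
  pi1_sg R y `<=` P.
Proof.
move=> P1 PF Pg; apply: smallest_sub; first exact/subgroupP.
move=> _ [z [a [b [[b' sb' /loop_classP bb'] ->]]]].
have -> : loop_class (path_cat (path_cat a b) (path_rev a)) =
          loop_class (path_cat (path_cat a b') (path_rev a)).
  by apply/loop_classP; rewrite bb'.
exact: Pg.
Qed.

Lemma pi1_sg_group y : subgroup (pi1_sg R y).
Proof.
apply/subgroupP; split.
  by move=> H [/subgroupP[H1 _] _].
move=> c d sc sd H HH; have [/subgroupP[_ HF] _] := HH.
by apply: HF; [exact: sc|exact: sd].
Qed.

Lemma pi1_sg1 y : pi1_sg R y 1%g.
Proof. by have /subgroupP[] := pi1_sg_group y. Qed.

Lemma pi1_sgF y c d : pi1_sg R y c -> pi1_sg R y d -> pi1_sg R y (c / d)%g.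
Proof. by have /subgroupP[_] := pi1_sg_group y; apply. Qed.

Lemma pi1_sgV y c : pi1_sg R y c -> pi1_sg R y (c^-1)%g.
Proof. by move=> sc; rewrite -div1g; apply: pi1_sgF => //; exact: pi1_sg1. Qed.

Lemma pi1_sgM y c d : pi1_sg R y c -> pi1_sg R y d -> pi1_sg R y (c * d)%g.
Proof. by move=> sc /pi1_sgV sd; rewrite -[d]invgK; exact: pi1_sgF. Qed.

Lemma pi1_sg_gen y z (a : {path I from y to z}) (b : {path I from z to z}) :
  small_loop b ->
  pi1_sg R y (loop_class (path_cat (path_cat a b) (path_rev a))).
Proof.
move=> sb; apply: sub_gen_smallest; exists z, a, b; split => //.
by exists b.
Qed.

Lemma pi1_sg_small y (b : {path I from y to y}) :
  small_loop b -> pi1_sg R y (loop_class b).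
Proof.
move=> /(pi1_sg_gen (path_cst y)).
by congr (pi1_sg R y); apply/loop_classP;
  rewrite homotopic_rev_cst homotopic_catp1 homotopic_cat1p.
Qed.

(** Conjugation along [a] turns the generator with tail [a'] into the one with tail [path_cat a a'],
    and respects quotients. *)
Lemma pi1_sg_conj x y (a : {path I from x to y}) (b : {path I from y to y}) :
  pi1_sg R y (loop_class b) ->
  pi1_sg R x (loop_class (path_cat (path_cat a b) (path_rev a))).
Proof.
(* Conjugation along a path acts on loops, not on classes, so the predicate ranges over all
   representatives. *)
pose P (c : pi1 R y) := forall g, c = loop_class g ->
  pi1_sg R x (loop_class (path_cat (path_cat a g) (path_rev a))).
suff H : pi1_sg R y `<=` P by move=> /H; apply.
apply: pi1_sg_ind.
- move=> g /loop_classP g1.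
  have -> : loop_class (path_cat (path_cat a g) (path_rev a)) = 1%g.
    by apply/loop_classP; rewrite -g1 homotopic_catp1 homotopic_cat_rev.
  exact: pi1_sg1.
- move=> c d; have [f ->] := loop_class_ex c; have [h ->] := loop_class_ex d.
  move=> /(_ f erefl) Pf /(_ h erefl) Ph g.
  rewrite loop_classV loop_classM => /loop_classP fhg.
  have := pi1_sgF Pf Ph; rewrite loop_classV loop_classM.
  congr (pi1_sg R x); apply/loop_classP; rewrite -fhg.
  by rewrite !homotopic_revM path_revK !homotopic_catA homotopic_catVK.
- move=> z a' b' sb' g /loop_classP g1.
  have := pi1_sg_gen (path_cat a a') sb'.
  congr (pi1_sg R x); apply/loop_classP; rewrite -g1.
  by rewrite !homotopic_revM !homotopic_catA.
Qed.

End space.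

Section functoriality.
Context {Y Z : topologicalType} (f : continuousType Y Z).

Lemma small_loop_map y (b : {path I from y to y}) :
  small_loop b -> small_loop (Defs.path_map f b).
Proof.
move=> sb V [oV Vfy]; have [|b' b'V bb'] := sb (f @^-1` V).
  by split => //; apply: open_comp => // z _; exact: cts_fun.
exists (Defs.path_map f b'); last exact: homotopic_map.
by move=> _ [s _ <-]; apply: b'V; exists s.
Qed.

Lemma pi1_sg_map y c : pi1_sg R y c -> pi1_sg R (f y) (pi1_map f c).
Proof.
pose P c := pi1_sg R (f y) (pi1_map f c).
suff H : pi1_sg R y `<=` P by apply: H.
apply: pi1_sg_ind.
- by rewrite /P gmulf1; exact: pi1_sg1.
- by move=> {}c d Pc Pd; rewrite /P gmulfF; exact: pi1_sgF.
- move=> z a b /small_loop_map/(pi1_sg_gen (Defs.path_map f a)).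
  rewrite /P pi1_mapE; congr (pi1_sg R (f y)); apply/loop_classP/homotopic_eq.
  move=> s; apply/esym; move: s.
  by apply: path_cat_map; [exact: path_cat_map|exact: path_rev_map].
Qed.

End functoriality.
End small_generated_subgroup.

(** * Lifting homotopies of paths *)

Section homotopy_lifting.
Context {R : realType} {E X : topologicalType}.
Local Notation I := (unit_interval R).
Variables (p : E -> X).
Hypothesis cov : covering p.

(** Unique lifting identifies three sides of the lifted square: [ft] at time zero, and constants
    along both end points. The fourth side is the lift of [g], and it ends at [e1]. *)
Lemma homotopy_lift x y (f g : {path I from x to y}) e e1
    (ft : {path I from e to e1}) : p \o ft =1 f -> homotopic f g ->
  exists2 gt : {path I from e to e1}, p \o gt =1 g & homotopic ft gt.
Proof.
move=> pft [H [cH H0 H1 Hx Hy]].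
have pe : p e = x by have := pft zero; rewrite /= !path_zero.
have pe1 : p e1 = y by have := pft one; rewrite /= !path_one.
have [|K [cK pK K0]] := @square_lift R _ _ _ cov H e cH; first by rewrite Hx.
have cKl (t : I) : continuous (fun s : I => K (s, t)).
  by apply: contC cK; apply: contP => [z|]; [exact: cvg_id|exact: contcst].
have cKr (s : I) : continuous (fun t : I => K (s, t)).
  by apply: contC cK; apply: contP => [|z]; [exact: contcst|exact: cvg_id].
have Kf s : K (s, zero) = ft s.
  apply: (path_lift_unique cov (k := fun s : I => K (s, zero)) (k' := ft)) => //.
  - exact: cts_fun.
  - by rewrite K0 path_zero.
  - by move=> r; rewrite [LHS](pK (r, zero)) H0 -pft.
have Ke t : K (zero, t) = e.
  apply: (path_lift_unique cov (k := fun t : I => K (zero, t))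
    (k' := fun=> e)) => //; first exact: contcst.
  by move=> r; rewrite [LHS](pK (zero, r)) Hx pe.
have Ke1 t : K (one, t) = e1.
  apply: (path_lift_unique cov (k := fun t : I => K (one, t))
    (k' := fun=> e1)) => //; first exact: contcst.
    by rewrite Kf path_one.
  by move=> r; rewrite [LHS](pK (one, r)) Hy pe1.
exists (mk_path (cKl one) (Ke one) (Ke1 one)).
  by move=> s; rewrite /= /mk_path [LHS](pK (s, one)) H1.
by exists K; split.
Qed.

Lemma homotopy_lift_end x y (f g : {path I from x to y}) e e1 e2
    (ft : {path I from e to e1}) (gt : {path I from e to e2}) :
  p \o ft =1 f -> p \o gt =1 g -> homotopic f g -> e1 = e2.
Proof.
move=> pft pgt /(homotopy_lift pft)[gt' pgt' _].
suff /(_ one) : gt' =1 gt by rewrite !path_one.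
apply: (path_lift_unique cov) => [|||s]; rewrite ?path_zero //; try exact: cts_fun.
by rewrite -[LHS]/((p \o gt') s) pgt' -pgt.
Qed.

End homotopy_lifting.

(** * Consequences of a small generated covering, and universality *)

Section covering_spaces.
Context {R : realType}.
Local Notation I := (unit_interval R).

Lemma sheet_comp_continuous {E X T : topologicalType} (p : E -> X) U V g
    (h : T -> X) :
  sheet p U V g -> continuous h -> (forall t, U (h t)) -> continuous (g \o h).
Proof.
move=> S ch Uh t; apply: continuous_comp; first exact: ch.
by apply: (sheet_cts S); exact: Uh.
Qed.

(** The loop lifts through [g] to a loop of [E], which is in [pi1_sg] there, and [p] preserves
    [pi1_sg]. *)
Lemma pi1_sg_section_loop {E X : topologicalType} (p : continuousType E X) U V g
    e (f : {path I from p e to p e}) :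
  small_generated R E -> sheet p U V g -> V e -> range f `<=` U ->
  pi1_sg R (p e) (loop_class f).
Proof.
move=> sgE S Ve fU.
have Uf s : U (f s) by apply: fU; exists s.
have cg : continuous (g \o f).
  by apply: (sheet_comp_continuous S) => //; exact: cts_fun.
have g0 : (g \o f) zero = e by rewrite /= path_zero (sheet_ret S).
have g1 : (g \o f) one = e by rewrite /= path_one (sheet_ret S).
have : pi1_sg R e (loop_class (mk_path cg g0 g1)) by rewrite -sgE.
move=> /(pi1_sg_map (f := p)); rewrite pi1_mapE.
congr (pi1_sg R (p e)); apply/loop_classP/homotopic_eq => s.
by rewrite /Defs.path_map /= /mk_path /= (sheet_sec S).
Qed.

Lemma small_generated_covering_semilocal {E X : topologicalType} (p : E -> X) :
  small_generated_covering R p -> semi_locally_small_generated R X.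
Proof.
move=> [cov _ sgE] x; have [cp surj _] := cov.
have [e _ <-] : range p x by rewrite surj.
have [U [V [g [[oU Upe] S Ve]]]] := covering_sheet e cov.
exists U, (mem_set Upe); split => // _ [c _ <-].
have [f ->] := loop_class_ex c; rewrite pi1_mapE.
apply: (pi1_sg_section_loop (p := mkcts cp) sgE S Ve) => _ [s _ <-].
exact: set_mem (valP (f s)).
Qed.

Lemma sheet_path_connected_nbhs {E X : topologicalType} (p : E -> X) U V g e W :
  locally_path_connected R X -> open U -> sheet p U V g -> V e ->
  open_nbhs e W ->
  exists N, [/\ open_nbhs (p e) N, N `<=` U, g @` N `<=` W & path_connected R N].
Proof.
move=> lpcX oU S Ve We; have Upe := sheet_sub S Ve.
have [|B Bpe BW] := open_nbhs_preimage (V := W) (sheet_cts S Upe).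
  by rewrite (sheet_ret S Ve).
have [N [Npe NBU pN]] := lpcX _ _ (open_nbhsI Bpe (conj oU Upe)).
exists N; split => // [u /NBU[]//|_ [u /NBU[Bu _] <-]]; exact: BW.
Qed.

Lemma covering_locally_path_connected {E X : topologicalType} (p : E -> X) :
  locally_path_connected R X -> covering p -> locally_path_connected R E.
Proof.
move=> lpcX cov e W We; have cp := covering_continuous cov.
have [U [V [g [[oU Upe] S Ve]]]] := covering_sheet e cov.
have [N [[oN Npe] NU gNW pN]] := sheet_path_connected_nbhs lpcX oU S Ve We.
exists (V `&` p @^-1` N); split.
- split => //; apply: openI; first exact: (sheet_open S).
  by apply: open_comp => // z _; exact: cp.
- by move=> v [Vv Nv]; rewrite -(sheet_ret S Vv); apply: gNW; exists (p v).
- move=> v v' [Vv Nv] [Vv' Nv']; have [f fN] := pN _ _ Nv Nv'.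
  have Nf s : N (f s) by apply: fN; exists s.
  have cg : continuous (g \o f).
    by apply: (sheet_comp_continuous S) => [|s]; [exact: cts_fun|exact: NU].
  have g0 : (g \o f) zero = v by rewrite /= path_zero (sheet_ret S).
  have g1 : (g \o f) one = v' by rewrite /= path_one (sheet_ret S).
  exists (mk_path cg g0 g1) => _ [s _ <-]; rewrite /mk_path /=.
  split; first by apply: (sheet_mem S); exact: NU.
  by rewrite /= (sheet_sec S) //; exact: NU.
Qed.

Lemma lift_path_cat {Z Y X : topologicalType} (f : Z -> X) (q : Y -> X)
    x y z (a : {path I from x to y}) (b : {path I from y to z})
    u v w (k : {path I from u to v}) (l : {path I from v to w}) :
  q \o k =1 f \o a -> q \o l =1 f \o b ->
  q \o path_cat k l =1 f \o path_cat a b.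
Proof.
move=> qk ql s; rewrite /= !path_catE !(fun_if q) !(fun_if f).
by rewrite -!/((q \o _) _) qk ql.
Qed.

Lemma lift_path_rev {Z Y X : topologicalType} (f : Z -> X) (q : Y -> X)
    x y (a : {path I from x to y}) u v (k : {path I from u to v}) :
  q \o k =1 f \o a -> q \o path_rev k =1 f \o path_rev a.
Proof. by move=> qk s; exact: qk. Qed.

Lemma pi1_sg_lift {Z Y X : topologicalType} (f : continuousType Z X) (q : Y -> X)
    z0 y0 (g : {path I from z0 to z0}) :
  covering q -> q y0 = f z0 -> pi1_sg R z0 (loop_class g) ->
  exists k : {path I from y0 to y0}, q \o k =1 f \o g.
Proof.
move=> cov qy.
(* One representative with a closed lift suffices, as [transfer] moves closed lifts along
   homotopies. *)
pose P (c : pi1 R z0) := exists (h : {path I from z0 to z0})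
  (k : {path I from y0 to y0}), c = loop_class h /\ q \o k =1 f \o h.
have transfer z y (b b' : {path I from z to z}) (k : {path I from y to y}) :
    q \o k =1 f \o b -> homotopic b b' ->
    exists k' : {path I from y to y}, q \o k' =1 f \o b'.
  move=> qk /(homotopic_map f)/(homotopy_lift cov qk)[k' qk' _].
  by exists k'.
suff H : pi1_sg R z0 `<=` P.
  by move=> /H[h [k [/loop_classP gh /transfer]]]; apply; exact: homotopic_sym.
apply: pi1_sg_ind.
- by exists (path_cst z0), (path_cst y0); split.
- move=> _ _ [h [k [-> qk]]] [h' [k' [-> qk']]].
  rewrite loop_classV loop_classM.
  exists (path_cat h (path_rev h')), (path_cat k (path_rev k')); split => //.
  by apply: lift_path_cat => //; exact: lift_path_rev.
- move=> z a b sb.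
  have [y1 [at_ qa]] := path_lift cov (Defs.path_map f a) qy.
  have qy1 : q y1 = f z by have := qa one; rewrite /= !path_one.
  have [U [V [h [[oU Uy1] S Vy1]]]] := covering_sheet y1 cov.
  (* Smallness deforms [b] until its image lies in the evenly covered [U]; the sheet inverse [h]
     then lifts it to a loop at [y1]. *)
  have [|b' b'V bb'] := sb (f @^-1` U).
    split; last by rewrite /= -qy1.
    by apply: open_comp => // t _; exact: cts_fun.
  have Ub s : U ((f \o b') s) by apply: b'V; exists s.
  have ck : continuous (h \o (f \o b')).
    by apply: (sheet_comp_continuous S) => //; exact: cts_fun.
  have k0 : (h \o (f \o b')) zero = y1.
    by rewrite /= path_zero -qy1 (sheet_ret S).
  have k1 : (h \o (f \o b')) one = y1.
    by rewrite /= path_one -qy1 (sheet_ret S).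
  have [|k qk] := transfer _ _ b' b (mk_path ck k0 k1) _ (homotopic_sym bb').
    by move=> s; rewrite /mk_path /= (sheet_sec S).
  exists (path_cat (path_cat a b) (path_rev a)),
         (path_cat (path_cat at_ k) (path_rev at_)); split => //.
  by apply: lift_path_cat; [exact: lift_path_cat|exact: lift_path_rev].
Qed.

(** The value of [r] at [z] is the end of the lift of [f \o a], for any path [a] from [z0] to [z];
    the relation [D] is the graph of [r]. *)
Lemma lifting_criterion {Z Y X : topologicalType} (f : continuousType Z X)
    (q : Y -> X) z0 y0 :
  locally_path_connected R Z -> path_connected R [set: Z] -> covering q ->
  q y0 = f z0 ->
  (forall g : {path I from z0 to z0}, exists k : {path I from y0 to y0},
    q \o k =1 f \o g) ->
  exists r : Z -> Y, [/\ continuous r, r z0 = y0 & q \o r =1 f].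
Proof.
move=> lpcZ pcZ cov qy loops.
pose D z y := exists (a : {path I from z0 to z}) (k : {path I from y0 to y}),
  q \o k =1 f \o a.
have Dfun z y y' : D z y -> D z y' -> y = y'.
  move=> [a [k qk]] [a' [k' qk']].
  (* As [l] is closed, [path_cat l k'] starts at [y0] and lifts the image of a path homotopic to
     [a], so it ends where [k] does. *)
  have [l ql] := loops (path_cat a (path_rev a')).
  apply: (homotopy_lift_end cov (f := Defs.path_map f a)
    (g := Defs.path_map f (path_cat (path_cat a (path_rev a')) a'))
    (ft := k) (gt := path_cat l k')) => //.
  + exact: lift_path_cat.
  + by apply: homotopic_map; rewrite homotopic_catVK.
have /choice[r Dr] z : exists y, D z y.
  have [a _] := pcZ z0 z Logic.I Logic.I.
  have [y [k qk]] := path_lift cov (Defs.path_map f a) qy.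
  by exists y, a, k.
have qr z : q (r z) = f z.
  by have [a [k /(_ one)]] := Dr z; rewrite /= !path_one.
exists r; split => //; last first.
  by apply: (Dfun z0) => //; exists (path_cst z0), (path_cst y0).
move=> z; apply: cvg_open => W [oW Wz].
have [U [V [g [[oU Uz] S Vz]]]] := covering_sheet (r z) cov.
have [|B [oB Bz] BW] := open_nbhs_preimage (V := W) (sheet_cts S Uz).
  by rewrite (sheet_ret S Vz).
have [|N [Nz NBU pN]] := lpcZ z (f @^-1` (B `&` U)).
  split; last by rewrite /= -qr.
  by apply: open_comp => [t _|]; [exact: cts_fun|exact: openI].
exists N => // z' Nz' /=; have [d dN] := pN _ _ (proj2 Nz) Nz'.
have BUd s : (B `&` U) (f (d s)) by apply: NBU; apply: dN; exists s.
(* Near [z], [r] coincides with [g \o f]: a path to [z] is continued by a path [d] inside [N], whose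
   image lifts through [g]. *)
suff -> : r z' = g (f z') by apply: BW; have [] := NBU _ Nz'.
apply: (Dfun z') => //; have [a [k qk]] := Dr z.
have ck : continuous (g \o (f \o d)).
  by apply: (sheet_comp_continuous S) => [|s]; [exact: cts_fun|case: (BUd s)].
have k0 : (g \o (f \o d)) zero = r z by rewrite /= path_zero -qr (sheet_ret S).
have k1 : (g \o (f \o d)) one = g (f z') by rewrite /= path_one.
exists (path_cat a d), (path_cat k (mk_path ck k0 k1)).
by apply: lift_path_cat => // s; rewrite /mk_path /= (sheet_sec S) //; case: (BUd s).
Qed.

(** Take a path connected [U] evenly covered by both [p] and [q], and a sheet [W] of [q] over [U].
    The sheets of [r] over [W] are the sheets of [p] over [U] that [r] maps into [W]. Surjectivity
    of [r] comes from lifting paths of [Y] through [p]. *)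
Lemma covering_tower {Z Y X : topologicalType} (p : Z -> X) (q : Y -> X)
    (r : Z -> Y) (z0 : Z) :
  locally_path_connected R X -> path_connected R [set: Y] ->
  covering p -> covering q -> continuous r -> q \o r =1 p -> covering r.
Proof.
move=> lpcX pcY covp covq cr qr.
have [cp _ evp] := covp; have [cq _ evq] := covq; split => //.
  apply/seteqP; split => // y _; have [a _] := pcY (r z0) y Logic.I Logic.I.
  have [|z1 [at_ pa]] := path_lift covp (Defs.path_map (mkcts cq) a) (e := z0).
    by rewrite -qr.
  exists z1 => //; suff /(_ one) : r \o at_ =1 a by rewrite /= !path_one.
  apply: (path_lift_unique covq); try exact: cts_fun.
  - by move=> s; apply: continuous_comp; [exact: cts_fun|exact: cr].
  - by rewrite /= !path_zero.
  - by move=> s; rewrite -[LHS]/((q \o r) (at_ s)) qr -[LHS]/((p \o at_) s) pa.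
move=> y; have [Up Upy ep] := evp (q y); have [Uq Uqy eq_] := evq (q y).
have [U [[oU Uy] UUU pU]] := lpcX _ _ (open_nbhsI Upy Uqy).
have {ep}[F [FE Ftriv Fs]] : evenly_covered p U.
  by apply: evenly_coveredW ep => // [|u /UUU[]//]; case: Upy.
have {eq_}eq_ : evenly_covered q U.
  by apply: evenly_coveredW eq_ => // [|u /UUU[]//]; case: Uqy.
have [W [gW [S Wy _]]] := evenly_covered_sheet oU eq_ Uy.
have oW := sheet_open S; exists W => //.
(* A sheet of [p] that meets the preimage of [W] lies in it: a path [d] in [U] has the lifts
   [r \o (gP \o d)] and [gW \o d] from the same point, so they coincide and end in [W]. *)
have stay P e e' : F P -> P e -> P e' -> W (r e) -> W (r e').
  move=> FP Pe Pe' We; have [oP hP] := Fs _ FP.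
  have [gP SP] := homeomorphism_on_sheet oU oP hP.
  have [d dU] := pU _ _ (sheet_sub SP Pe) (sheet_sub SP Pe').
  have Ud s : U (d s) by apply: dU; exists s.
  have : r \o (gP \o d) =1 gW \o d.
    apply: (path_lift_unique covq).
    - move=> s; apply: continuous_comp; last exact: cr.
      by apply: (sheet_comp_continuous SP) => //; exact: cts_fun.
    - by apply: (sheet_comp_continuous S) => //; exact: cts_fun.
    - by rewrite /= path_zero (sheet_ret SP) // -qr /= (sheet_ret S).
    - by move=> s; rewrite /= -[LHS]/((q \o r) _) qr (sheet_sec SP) // (sheet_sec S).
  move=> /(_ one) /=; rewrite path_one (sheet_ret SP) // => ->.
  by apply: (sheet_mem S); exact: (sheet_sub SP).
exists [set P | F P /\ r @` P `<=` W]; split.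
- apply/seteqP; split => e /=.
    move=> We; have : (p @^-1` U) e by rewrite /= -qr; exact: (sheet_sub S).
    rewrite FE => -[P FP Pe]; exists P => //; split => // _ [e' Pe' <-].
    exact: stay FP Pe Pe' We.
  by move=> [P [_ PW] Pe]; apply: PW; exists e.
- by move=> P P' [FP _] [FP' _]; exact: Ftriv.
- move=> P [FP PW]; have [oP hP] := Fs _ FP; split => //.
  have [gP SP] := homeomorphism_on_sheet oU oP hP.
  have mem w : W w -> P (gP (q w)).
    by move=> /(sheet_sub S); exact: (sheet_mem SP).
  apply: (@sheet_homeomorphism_on _ _ _ _ _ (gP \o q)) => //.
  split => //=.
  + by move=> e Pe; apply: PW; exists e.
  + move=> w Ww; have PWw : W (r (gP (q w))) by apply: PW; exists (gP (q w)); auto.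
    rewrite -(sheet_ret S PWw) -[q (r _)]/((q \o r) _) qr (sheet_sec SP).
      by rewrite (sheet_ret S).
    exact: (sheet_sub S).
  + by move=> e Pe; rewrite -[q (r e)]/((q \o r) e) qr (sheet_ret SP).
  + move=> w Ww; apply: continuous_comp; first exact: cq.
    by apply: (sheet_cts SP); exact: (sheet_sub S).
Qed.

Lemma small_generated_covering_universal {E X : topologicalType} (p : E -> X) :
  locally_path_connected R X ->
  small_generated_covering R p -> universal_covering R p.
Proof.
move=> lpcX [cov pcE sgE]; split => // x e <- Y q y covq pcY qy.
have cp := covering_continuous cov.
have lpcE := covering_locally_path_connected lpcX cov.
have [|r [cr re qr]] := lifting_criterion (f := mkcts cp) lpcE pcE covq qy.
  by move=> g; apply: (pi1_sg_lift (f := mkcts cp) covq qy); rewrite -sgE.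
exists r; split.
  split => //; last exact/funext.
  exact: (covering_tower e lpcX pcY cov covq cr qr).
move=> r' [covr' r'e qr']; apply/funext => z.
(* Uniqueness: both maps send a path from [e] to [z] to lifts of one path with a common start. *)
have [a _] := pcE e z Logic.I Logic.I.
suff /(_ one) : r \o a =1 r' \o a by rewrite /= path_one.
apply: (path_lift_unique covq).
- by move=> s; apply: continuous_comp; [exact: cts_fun|exact: cr].
- move=> s; apply: continuous_comp; first exact: cts_fun.
  exact: (covering_continuous covr').
- by rewrite /= path_zero re r'e.
- by move=> s; rewrite /= -[LHS]/((q \o r) _) qr -[RHS]/((q \o r') _) qr'.
Qed.

End covering_spaces.

(** * Path components and restrictions of a path *)

Section path_restriction.
Context {R : realType} {T : topologicalType}.
Local Notation I := (unit_interval R).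

(** A path component and its complement are both open, because nearby points are joined by paths. *)
Lemma connected_path_connected :
  connected [set: T] -> locally_path_connected R T -> path_connected R [set: T].
Proof.
move=> cT lpcT x y _ _; pose A := [set z | inhabited {path I from x to z}].
suff AT : A = setT.
  by have : A y by [rewrite AT]; move=> [f]; exists f.
have nbhsA z : exists2 V, open_nbhs z V & forall w, V w -> A z <-> A w.
  have [V [zV _ pV]] := lpcT z setT (conj openT Logic.I); exists V => // w Vw.
  have [f _] := pV _ _ (proj2 zV) Vw.
  by split=> -[g]; constructor; [exact: path_cat g f|exact: path_cat g (path_rev f)].
apply: clopen_connectedT => //.
- apply: open_locally => z Az; have [V zV VA] := nbhsA z.
  by exists V => // w /VA; tauto.
- apply: open_locally => z Az; have [V zV VA] := nbhsA z.
  by exists V => // w /VA; rewrite /= in Az *; tauto.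
- by exists x; constructor; exact: path_cst.
Qed.

Section segment.
Context {x y : T} (f : {path I from x to y}).

Let segment_fun (a b : I) (u : I) : T :=
  f (toI (ival a + ival u * (ival b - ival a))).

Let segment_cts a b : continuous (segment_fun a b).
Proof.
apply: cont_toI; first exact: cts_fun.
apply: contD; first exact: contcst.
by apply: contM; [exact: continuous_ival|exact: contcst].
Qed.

Let segment_zero a b : segment_fun a b zero = f a.
Proof. by rewrite /segment_fun ival_zero mul0r addr0 toI_ival. Qed.

Let segment_one a b : segment_fun a b one = f b.
Proof. by rewrite /segment_fun ival_one mul1r addrC subrK toI_ival. Qed.

(** The order of [a] and [b] is free; for [b] below [a] the segment runs backwards. *)
Definition path_segment a b : {path I from f a to f b} :=
  mk_path (@segment_cts a b) (@segment_zero a b) (@segment_one a b).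

Definition path_init b : {path I from x to f b} :=
  mk_path (@segment_cts zero b) (etrans (@segment_zero zero b) path_zero)
    (@segment_one zero b).

Lemma path_segmentE a b u :
  path_segment a b u = f (toI (ival a + ival u * (ival b - ival a))).
Proof. by []. Qed.

Lemma path_initE b u : path_init b u = f (toI (ival u * ival b)).
Proof.
by rewrite [LHS]/(f (toI (ival zero + ival u * (ival b - ival zero)))) ival_zero
  add0r subr0.
Qed.

Lemma homotopic_init_segment a b :
  homotopic (path_init b) (path_cat (path_init a) (path_segment a b)).
Proof.
(* Both sides reparametrize [f]. The second parameter runs from 0 to [a] in the first half of the
   time and from [a] to [b] in the second. *)
apply: (@homotopic_reparam _ _ _ _ f (fun u => ival u * ival b)
  (fun u => Num.min (2 * ival u) 1 * ival a +
            Num.max 0 (2 * ival u - 1) * (ival b - ival a))).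
- exact: cts_fun.
- by apply: contM; [exact: continuous_ival|exact: contcst].
- have c2 : continuous (fun u : I => 2 * ival u : R).
    by apply: contM; [exact: contcst|exact: continuous_ival].
  apply: contD; (apply: contM; last exact: contcst).
    by apply: contmin => //; exact: contcst.
  move=> u; apply: (@continuous_max R I (cst 0) (fun u => 2 * ival u - 1)).
    exact: cst_continuous.
  by apply: contB => //; exact: contcst.
- by rewrite ival_zero minEle maxEle; do !case: ifP; lra.
- by rewrite ival_one minEle maxEle; do !case: ifP; lra.
- exact: path_initE.
- move=> u; rewrite path_catE; have := ival_ge0 u; have := ival_le1 u => u1 u0.
  case: ifP => u2.
    rewrite path_initE ival_toI clampK; last lra.
    rewrite min_l; last lra.
    by rewrite max_l ?mul0r ?addr0 //; lra.
  rewrite path_segmentE ival_toI clampK; last lra.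
  rewrite min_r; last lra.
  by rewrite max_r ?mul1r //; lra.
Qed.

Lemma path_segment_near a (N : set T) : open_nbhs (f a) N ->
  exists2 J, open_nbhs a J & forall b, J b -> range (path_segment a b) `<=` N.
Proof.
move=> fN; have cf : continuous (fun t : R => f (toI t)).
  apply: (@contC _ _ _ (@toI R)); [exact: continuous_toI|exact: cts_fun].
have /cf /= : nbhs (f (toI (ival a))) N by rewrite toI_ival; exact: open_nbhs_nbhs.
move=> /nbhs_ballP[e /= e0 eN].
exists ((@ival R) @^-1` ball (ival a) e).
  split; last exact: ballxx.
  by apply: open_comp => [b _|]; [exact: continuous_ival|exact: ball_open].
move=> b ab _ [u _ <-]; apply: eN; move: ab; rewrite /ball /=.
have := ival_ge0 u; have := ival_le1 u => u1 u0.
rewrite !ltr_norml => /andP[ab1 ab2]; apply/andP; split; nra.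
Qed.

End segment.
End path_restriction.

(** * Construction of the small generated covering space *)

Section small_generated_cover.
Context {R : realType} {X : topologicalType} (x0 : X).
Local Notation I := (unit_interval R).
Local Notation path_from := {y : X & {path I from x0 to y}}.

(* Naming the path [g] of [v] with the end point of [u] avoids transporting paths
   along the equality of end points. *)
Definition sg_rel (u v : path_from) : Prop :=
  exists2 g : {path I from x0 to tag u}, v = Tagged _ g &
    pi1_sg R x0 (loop_class (path_cat (tagged u) (path_rev g))).

Let sg_relb u v := `[< sg_rel u v >].

Let sg_relb_refl : reflexive sg_relb.
Proof.
move=> [y f]; apply/asboolP; exists f => //=.
rewrite (_ : loop_class _ = 1%g); first exact: pi1_sg1.
by apply/loop_classP; exact: homotopic_cat_rev.
Qed.

Let sg_relb_sym : symmetric sg_relb.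
Proof.
suff sym u v : sg_rel u v -> sg_rel v u.
  by move=> u v; apply/asboolP/asboolP; exact: sym.
move: u => [y f] [g -> /= /pi1_sgV sg]; exists f => //=.
move: sg; rewrite loop_classV; congr (pi1_sg R x0); apply/loop_classP.
by rewrite homotopic_revM path_revK.
Qed.

Let sg_relb_trans : transitive sg_relb.
Proof.
move=> v [y f] w /asboolP[g -> /= sfg] /asboolP[h /= -> sgh].
apply/asboolP; exists h => //=; have := pi1_sgM sfg sgh; rewrite loop_classM.
congr (pi1_sg R x0); apply/loop_classP.
by rewrite homotopic_catA homotopic_catVK.
Qed.

Canonical sg_equiv := EquivRel sg_relb sg_relb_refl sg_relb_sym sg_relb_trans.

Definition sg_cover : Type := {eq_quot sg_equiv}.
HB.instance Definition _ := Choice.on sg_cover.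

Definition path_pt y (f : {path I from x0 to y}) : sg_cover :=
  \pi_({eq_quot sg_equiv}) (Tagged (fun y => {path I from x0 to y}) f).

Definition sg_proj (c : sg_cover) : X := tag (repr (c : {eq_quot sg_equiv})).

Lemma path_pt_ex (c : sg_cover) : exists y (f : {path I from x0 to y}), c = path_pt f.
Proof.
exists (tag (repr (c : {eq_quot sg_equiv}))),
  (tagged (repr (c : {eq_quot sg_equiv}))).
by rewrite /path_pt; case: (repr _) (reprK (c : {eq_quot sg_equiv})) => y f /= <-.
Qed.

Lemma path_pt_rel y z (f : {path I from x0 to y}) (g : {path I from x0 to z}) :
  path_pt f = path_pt g <-> sg_rel (Tagged _ f) (Tagged _ g).
Proof. by split => [/eqmodP/asboolP//|fg]; apply/eqmodP/asboolP. Qed.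

Lemma path_ptP y (f g : {path I from x0 to y}) : path_pt f = path_pt g <->
  pi1_sg R x0 (loop_class (path_cat f (path_rev g))).
Proof.
rewrite path_pt_rel; split; last by exists g.
(* Boolean equality of the tags reduces equality of the dependent pairs to equality of the paths. *)
by move=> [g' /eqP]; rewrite -tag_eqE /tag_eq eqxx /= tagged_asE => /eqP <-.
Qed.

Lemma sg_projE y (f : {path I from x0 to y}) : sg_proj (path_pt f) = y.
Proof.
rewrite /sg_proj; have : path_pt f =
    path_pt (tagged (repr (path_pt f : {eq_quot sg_equiv}))).
  rewrite {2}/path_pt.
  by case: (repr _) (reprK (path_pt f : {eq_quot sg_equiv})) => z g /= ->.
by move=> /path_pt_rel[g /(congr1 tag)].
Qed.
Lemma path_pt_eq y z (f : {path I from x0 to y}) (g : {path I from x0 to z}) :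
  f =1 g -> path_pt f = path_pt g.
Proof.
move=> fg; have yz : y = z by rewrite -(path_one (s := f)) fg path_one.
by subst z; move/path_eqP : fg => ->.
Qed.

Lemma path_pt_homotopic y (f g : {path I from x0 to y}) :
  homotopic f g -> path_pt f = path_pt g.
Proof.
move=> fg; apply/path_ptP; rewrite (_ : loop_class _ = 1%g); first exact: pi1_sg1.
by apply/loop_classP; rewrite fg homotopic_cat_rev.
Qed.

Lemma path_pt_catI y z (f f' : {path I from x0 to y}) (g : {path I from y to z}) :
  path_pt (path_cat f g) = path_pt (path_cat f' g) <-> path_pt f = path_pt f'.
Proof.
rewrite !path_ptP (_ : loop_class (path_cat (path_cat f g) _) =
  loop_class (path_cat f (path_rev f'))) //.
by apply/loop_classP; rewrite homotopic_revM homotopic_catA homotopic_catK.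
Qed.

(** The two memberships differ by conjugation along [f], under which [pi1_sg] is stable in both
    directions. *)
Lemma path_pt_catP y z (f : {path I from x0 to y}) (g g' : {path I from y to z}) :
  path_pt (path_cat f g) = path_pt (path_cat f g') <->
  pi1_sg R y (loop_class (path_cat g (path_rev g'))).
Proof.
rewrite path_ptP; split => [/(pi1_sg_conj (path_rev f))|/(pi1_sg_conj f)].
  congr (pi1_sg R y); apply/loop_classP; rewrite path_revK homotopic_revM.
  rewrite !homotopic_catA homotopic_catVK.
  by rewrite homotopic_rev_cat homotopic_cat1p.
congr (pi1_sg R x0); apply/loop_classP.
by rewrite homotopic_revM !homotopic_catA.
Qed.

(** Decides which loops of [X] have a closed lift at [path_pt f]. *)
Lemma path_pt_loop y (f : {path I from x0 to y}) (b : {path I from y to y}) :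
  path_pt (path_cat f b) = path_pt f <-> pi1_sg R y (loop_class b).
Proof.
rewrite -[X in _ = X](path_pt_homotopic (homotopic_catp1 f)) path_pt_catP.
rewrite (_ : loop_class (path_cat b _) = loop_class b) //.
by apply/loop_classP; rewrite homotopic_rev_cst homotopic_catp1.
Qed.

(** The usual basic sets of a space of path classes: [f] is prolonged inside [U]. They generate the
    topology defined by [sg_open]. *)
Definition sg_ball y (f : {path I from x0 to y}) (U : set X) : set sg_cover :=
  [set c | exists z (g : {path I from y to z}),
     c = path_pt (path_cat f g) /\ range g `<=` U].

Lemma sg_ball_center y (f : {path I from x0 to y}) U :
  U y -> sg_ball f U (path_pt f).
Proof.
move=> Uy; exists y, (path_cst y); split; last by move=> _ [s _ <-].
by rewrite (path_pt_homotopic (homotopic_catp1 f)).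
Qed.

Lemma sg_ballS y (f : {path I from x0 to y}) U V :
  U `<=` V -> sg_ball f U `<=` sg_ball f V.
Proof. by move=> UV _ [z [g [-> gU]]]; exists z, g; split => // t /gU/UV. Qed.

Lemma sg_ball_eq y (f f' : {path I from x0 to y}) U :
  path_pt f = path_pt f' -> sg_ball f U = sg_ball f' U.
Proof.
by move=> ff'; apply/seteqP; split => _ [z [g [-> gU]]]; exists z, g; split => //;
  apply/path_pt_catI.
Qed.

Lemma range_path_cat y z w (g : {path I from y to z}) (h : {path I from z to w})
    (U : set X) :
  range g `<=` U -> range h `<=` U -> range (path_cat g h) `<=` U.
Proof.
move=> gU hU _ [s _ <-]; rewrite path_catE.
by case: ifP => _; [apply: gU|apply: hU]; eexists.
Qed.

Lemma range_path_rev y z (g : {path I from y to z}) (U : set X) :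
  range g `<=` U -> range (path_rev g) `<=` U.
Proof. by move=> gU _ [s _ <-]; apply: gU; eexists. Qed.

Lemma sg_ball_trans y z (f : {path I from x0 to y}) (f' : {path I from x0 to z}) U :
  sg_ball f U (path_pt f') -> sg_ball f' U `<=` sg_ball f U.
Proof.
move=> [z' [g [f'E gU]]] _ [w [h [-> hU]]].
have zz' : z' = z by rewrite -(sg_projE f') f'E sg_projE.
subst z'; exists w, (path_cat g h); split; last exact: range_path_cat.
by rewrite (path_pt_homotopic (homotopic_catA _ _ _)); apply/path_pt_catI.
Qed.

Let sg_open (O : set sg_cover) : Prop :=
  forall y (f : {path I from x0 to y}), O (path_pt f) ->
    exists2 U, open_nbhs y U & sg_ball f U `<=` O.

Let sg_openT : sg_open setT.
Proof. by move=> y f _; exists setT => //; split => //; exact: openT. Qed.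

Let sg_openI : setI_closed sg_open.
Proof.
move=> O O' oO oO' y f [/oO[U Uy UO] /oO'[U' U'y U'O']].
exists (U `&` U'); first exact: open_nbhsI.
by move=> c cU; split; [apply: UO|apply: U'O']; apply: sg_ballS cU => t [].
Qed.

Let sg_open_bigcup (J : Type) (O : J -> set sg_cover) :
  (forall i, sg_open (O i)) -> sg_open (\bigcup_i O i).
Proof.
move=> oO y f [i _ /oO[U Uy UO]]; exists U => // c /UO; by exists i.
Qed.

HB.instance Definition _ :=
  isOpenTopological.Build sg_cover sg_openT sg_openI sg_open_bigcup.

Lemma sg_coverE (O : set sg_cover) : open O <->
  forall y (f : {path I from x0 to y}), O (path_pt f) ->
    exists2 U, open_nbhs y U & sg_ball f U `<=` O.
Proof. by []. Qed.

Lemma open_sg_ball y (f : {path I from x0 to y}) U : open U -> open (sg_ball f U).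
Proof.
move=> oU; apply/sg_coverE => z f' Uf'; exists U; last exact: sg_ball_trans.
split => //; have [z' [g [f'E gU]]] := Uf'.
have zz' : z' = z by rewrite -(sg_projE f') f'E sg_projE.
by subst z'; rewrite -(path_one (s := g)); apply: gU; exists one.
Qed.

Lemma sg_ball_proj y (f : {path I from x0 to y}) U c : sg_ball f U c -> U (sg_proj c).
Proof.
move=> [z [g [-> gU]]]; rewrite sg_projE -(path_one (s := g)).
by apply: gU; exists one.
Qed.

Lemma sg_proj_continuous : continuous sg_proj.
Proof.
move=> c; have [y [f ->]] := path_pt_ex c; apply: cvg_open => V; rewrite sg_projE.
move=> [oV Vy]; exists (sg_ball f V); last exact: sg_ball_proj.
by split; [exact: open_sg_ball|exact: sg_ball_center].
Qed.

(** The lift at time [s] is the class of [f] followed by [g] up to [s]; it is continuous since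
    moving [s] slightly appends a short segment of [g]. The range clause later makes lifts of small
    loops small. *)
Lemma sg_path_lift y z (f : {path I from x0 to y}) (g : {path I from y to z}) :
  exists k : {path I from path_pt f to path_pt (path_cat f g)},
    sg_proj \o k =1 g /\ forall U, range g `<=` U -> range k `<=` sg_ball f U.
Proof.
pose k (s : I) := path_pt (path_cat f (path_init g s)).
have ck : continuous k.
  move=> a; apply: cvg_open => O [oO Oa].
  have [N Na NO] := (sg_coverE O).1 oO _ _ Oa.
  have [J Ja JN] := path_segment_near Na; exists J => // b /JN bN /=.
  apply: NO; exists (g b), (path_segment g a b); split => //.
  apply: path_pt_homotopic; rewrite -homotopic_catA.
  by apply: homotopic_cat => //; exact: homotopic_init_segment.
have k0 : k zero = path_pt f.
  rewrite -[RHS](path_pt_homotopic (homotopic_catp1 f)); apply: path_pt_eq => s.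
  rewrite !path_catE; case: ifP => // _.
  by rewrite path_initE ival_zero mulr0 toI_le0 // path_zero.
have k1 : k one = path_pt (path_cat f g).
  apply: path_pt_eq => s; rewrite !path_catE; case: ifP => // _.
  by rewrite path_initE ival_one mulr1 toI_ival.
exists (mk_path ck k0 k1); split => [s|U gU _ [s _ <-]].
  by rewrite /= /mk_path sg_projE.
exists (g s), (path_init g s); split => // _ [u _ <-].
by rewrite path_initE; apply: gU; eexists.
Qed.

Lemma sg_cover_path_connected : path_connected R [set: sg_cover].
Proof.
move=> c c' _ _; have [y [f ->]] := path_pt_ex c; have [z [g ->]] := path_pt_ex c'.
have [k _] := sg_path_lift f (path_cat (path_rev f) g).
suff e : path_pt (path_cat f (path_cat (path_rev f) g)) = path_pt g.
  by move: k; rewrite e => k; exists k.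
apply: path_pt_homotopic.
by rewrite homotopic_catA homotopic_cat_rev homotopic_cat1p.
Qed.

Hypothesis lpcX : locally_path_connected R X.

(** Injectivity on the ball: two prolongations within [V] to the same point differ by a loop in [V],
    which is in [pi1_sg] by hypothesis. *)
Lemma sg_ball_sheet x (f : {path I from x0 to x}) V :
  open V -> V x -> path_connected R V ->
  (forall g : {path I from x to x}, range g `<=` V -> pi1_sg R x (loop_class g)) ->
  exists g, sheet sg_proj V (sg_ball f V) g.
Proof.
move=> oV Vx pV loopV.
(* The inverse picks the point of the ball over [z]; [path_pt f] is a default value for [z] outside
   [V]. *)
pose s z := xget (path_pt f) [set c | sg_ball f V c /\ sg_proj c = z].
have sP z : V z -> sg_ball f V (s z) /\ sg_proj (s z) = z.
  move=> Vz; rewrite /s; have [g gV] := pV _ _ Vx Vz.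
  case: xgetP => [c _ [] //|/(_ (path_pt (path_cat f g)))[]].
  by split; [exists z, g|rewrite sg_projE].
have inj c c' : sg_ball f V c -> sg_ball f V c' -> sg_proj c = sg_proj c' -> c = c'.
  move=> [z [g [-> gV]]] [z' [g' [-> g'V]]]; rewrite !sg_projE => zz'; subst z'.
  apply/path_pt_catP; apply: loopV; apply: range_path_cat => //.
  exact: range_path_rev.
exists s; split.
- exact: open_sg_ball.
- by move=> c /sg_ball_proj.
- by move=> z /sP[].
- by move=> z /sP[].
- move=> c fc; have [sc ?] := sP _ (sg_ball_proj fc); exact: inj.
- move=> z Vz; apply: cvg_open => O [oO Oz].
  have [[z' [g [sE gV]]] sz] := sP z Vz.
  have zz' : z' = z by rewrite -sz sE sg_projE.
  subst z'; have [N Nz NO] :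
      exists2 N, open_nbhs z N & sg_ball (path_cat f g) N `<=` O.
    by apply: (sg_coverE O).1 => //; rewrite -sE.
  have [W [Wz WNV pW]] := lpcX (open_nbhsI Nz (conj oV Vz)).
  exists W => // w Ww /=; have [d dW] := pW _ _ (proj2 Wz) Ww.
  have [Vw Nw] : V w /\ N w by have [] := WNV _ Ww.
  (* Near [z] the section is the prolongation of [path_cat f g] by a path [d] in [W], hence stays in
     the ball over [N]. *)
  have -> : s w = path_pt (path_cat (path_cat f g) d).
    have [sw pw] := sP w Vw; apply: inj => //; last by rewrite pw sg_projE.
    exists w, (path_cat g d); split; last first.
      by apply: range_path_cat => // t /dW/WNV[].
    by apply: path_pt_homotopic; rewrite homotopic_catA.
  by apply: NO; exists w, d; split => // t /dW/WNV[].
Qed.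

Lemma semilocal_loop (x : X) (U : set X) (Ux : x \in U) (g : {path I from x to x}) :
  range (@pi1_map R _ _ (@Defs.incl X U) (SigSub Ux)) `<=` pi1_sg R x ->
  range g `<=` U -> pi1_sg R x (loop_class g).
Proof.
move=> sU gU; have Ug s : g s \in U by apply/mem_set/gU; exists s.
pose h s : U := SigSub (Ug s).
have ch : continuous h.
  apply: (@continuous_comp_initial _ _ _ set_val h).
  have -> : set_val \o h = g by rewrite set_valE.
  exact: cts_fun.
have h0 : h zero = SigSub Ux by apply: val_inj; rewrite /= path_zero.
have h1 : h one = SigSub Ux by apply: val_inj; rewrite /= path_one.
have /sU : range (@pi1_map R _ _ (@Defs.incl X U) (SigSub Ux))
    (pi1_map (@Defs.incl X U) (loop_class (mk_path ch h0 h1))) by eexists.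
rewrite pi1_mapE; congr (pi1_sg R x); apply/loop_classP.
exact: homotopic_eq.
Qed.

Lemma sg_proj_covering : path_connected R [set: X] ->
  semi_locally_small_generated R X -> covering sg_proj.
Proof.
move=> pcX slX; split; first exact: sg_proj_continuous.
  apply/seteqP; split => // y _; have [f _] := pcX x0 y Logic.I Logic.I.
  by exists (path_pt f); rewrite ?sg_projE.
move=> x; have [U [Ux [oU sU]]] := slX x.
have [V [[oV Vx] VU pV]] := lpcX (conj oU (set_mem Ux)).
have loopV (g : {path I from x to x}) : range g `<=` V -> pi1_sg R x (loop_class g).
  by move=> gV; apply: semilocal_loop sU _ => t /gV/VU.
(* The sheets are the balls centred at the points over [x]; two balls with a common point have the
   same centre, again because loops in [V] are in [pi1_sg]. *)
exists V => //; exists [set S | exists f : {path I from x0 to x}, S = sg_ball f V].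
split.
- apply/seteqP; split => [c /=|c [_ [f ->] /sg_ball_proj]//].
  have [z [f ->]] := path_pt_ex c; rewrite sg_projE => Vz.
  have [d dV] := pV _ _ Vz Vx; exists (sg_ball (path_cat f d) V).
    by exists (path_cat f d).
  exists z, (path_rev d); split; last exact: range_path_rev.
  by apply: path_pt_homotopic; rewrite homotopic_catK.
- move=> _ _ [f ->] [f' ->] [c [[z [g [-> gV]]] [z' [g' [ff' g'V]]]]].
  have zz' : z' = z by rewrite -(sg_projE (path_cat f g)) ff' sg_projE.
  subst z'; apply: sg_ball_eq; apply/(path_pt_catI _ _ g'); rewrite -ff'.
  apply/path_pt_catP; apply: loopV; apply: range_path_cat => //.
  exact: range_path_rev.
- move=> _ [f ->]; split; first exact: open_sg_ball.
  have [g S] := sg_ball_sheet f oV Vx pV loopV.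
  by apply: (sheet_homeomorphism_on _ oV S) => c _; exact: sg_proj_continuous.
Qed.

Lemma pi1_sg_cover_lift y (f : {path I from x0 to y}) (c : pi1 R y) :
  covering sg_proj -> pi1_sg R y c ->
  exists (b : {path I from y to y}) (k : {path I from path_pt f to path_pt f}),
    [/\ c = loop_class b, sg_proj \o k =1 b & pi1_sg R (path_pt f) (loop_class k)].
Proof.
move=> cov; pose P (c : pi1 R y) := exists (b : {path I from y to y})
  (k : {path I from path_pt f to path_pt f}),
  [/\ c = loop_class b, sg_proj \o k =1 b & pi1_sg R (path_pt f) (loop_class k)].
suff H : pi1_sg R y `<=` P by move=> /H.
apply: pi1_sg_ind.
- exists (path_cst y), (path_cst (path_pt f)); split => //.
    by move=> s; rewrite /= sg_projE.
  by rewrite loop_class1; exact: pi1_sg1.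
- move=> _ _ [b [k [-> kb sk]]] [b' [k' [-> kb' sk']]].
  exists (path_cat b (path_rev b')), (path_cat k (path_rev k')); split.
  + by rewrite loop_classV loop_classM.
  + by apply: path_cat_map => //; exact: path_rev_map.
  + by have := pi1_sgF sk sk'; rewrite loop_classV loop_classM.
- move=> z a b sb; have [ka [pka _]] := sg_path_lift f a.
  (* Each loop homotopic to [b] is in [pi1_sg], so its lift closes up. *)
  have loop (b' : {path I from z to z}) : homotopic b b' ->
      path_pt (path_cat (path_cat f a) b') = path_pt (path_cat f a).
    move=> bb'; apply/path_pt_loop; rewrite -(loop_classP b b').2 //.
    exact: pi1_sg_small.
  have lift (b' : {path I from z to z}) : homotopic b b' ->
      exists k : {path I from path_pt (path_cat f a) to path_pt (path_cat f a)},
      sg_proj \o k =1 b' /\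
      forall U, range b' `<=` U -> range k `<=` sg_ball (path_cat f a) U.
    by move=> bb'; have := sg_path_lift (path_cat f a) b'; rewrite loop.
  have [kb [pkb _]] := lift b (homotopic_refl b).
  have skb : small_loop kb.
    (* [O] contains a ball over some [N]. Deforming [b] into [N] gives a loop whose lift stays in
       that ball; it is homotopic to [kb] by homotopy lifting and uniqueness. *)
    move=> O [oO Oa]; have [N Nz NO] := (sg_coverE O).1 oO _ _ Oa.
    have [b' b'N bb'] := sb N Nz; have [k' [pk' k'N]] := lift b' bb'.
    exists k'; first by move=> t /(k'N N b'N)/NO.
    have [k pk kbk] := homotopy_lift cov pkb bb'.
    suff -> : k' = k by [].
    apply/path_eqP; apply: (path_lift_unique cov); try exact: cts_fun.
      by rewrite !path_zero.
    by move=> s; rewrite -!/((sg_proj \o _) s) pk pk'.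
  exists (path_cat (path_cat a b) (path_rev a)),
         (path_cat (path_cat ka kb) (path_rev ka)); split => //.
    by apply: path_cat_map; [exact: path_cat_map|exact: path_rev_map].
  exact: pi1_sg_gen.
Qed.

Lemma sg_cover_small_generated : covering sg_proj -> small_generated R sg_cover.
Proof.
move=> cov c; apply/seteqP; split => // d _.
have [k ->] := loop_class_ex d; have [y [f cE]] := path_pt_ex c; subst c.
have cb : continuous (sg_proj \o k).
  by move=> s; apply: continuous_comp; [exact: cts_fun|exact: sg_proj_continuous].
have b0 : (sg_proj \o k) zero = y by rewrite /= path_zero sg_projE.
have b1 : (sg_proj \o k) one = y by rewrite /= path_one sg_projE.
pose b := mk_path cb b0 b1 : {path I from y to y}.
have : pi1_sg R y (loop_class b).
  (* The standard lift of [b] ends at [path_pt (path_cat f b)], while the lift [k] is closed; lifts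
     with the same start have the same end. *)
  apply/(path_pt_loop f); have [k' [pk' _]] := sg_path_lift f b.
  exact: (homotopy_lift_end cov (f := b) (g := b) pk' (gt := k)).
move=> /(pi1_sg_cover_lift f cov)[b' [k' [/loop_classP bb' pk' sk']]].
have [k'' pk'' k'k''] := homotopy_lift cov pk' (homotopic_sym bb').
suff -> : k = k'' by rewrite -(loop_classP k' k'').2.
apply/path_eqP; apply: (path_lift_unique cov); try exact: cts_fun.
  by rewrite !path_zero.
by move=> s; rewrite -!/((sg_proj \o _) s) pk''.
Qed.

End small_generated_cover.

Theorem theorem3p6 (R : realType) (X : topologicalType)
    (Xconn : connected [set: X]) (Xlpc : locally_path_connected R X) :
  ((exists (Xt : topologicalType) (p : Xt -> X), small_generated_covering R p)
   <-> semi_locally_small_generated R X) /\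
  (forall (Xt : topologicalType) (p : Xt -> X),
     small_generated_covering R p -> universal_covering R p).
Proof.
split; last by move=> Xt p; exact: small_generated_covering_universal.
split=> [[Xt [p /small_generated_covering_semilocal//]]|slX].
have [[x0]|X0] := pselect (inhabited X).
  have cov := sg_proj_covering x0 Xlpc (connected_path_connected Xconn Xlpc) slX.
  exists (sg_cover x0), (@sg_proj R X x0); split => //.
    exact: sg_cover_path_connected.
  exact: sg_cover_small_generated.
(* The empty space also counts as connected here; its identity map is a small generated covering
   vacuously. *)
have noX (x : X) : False by apply: X0.
exists X, id; split.
- split; [by move=> x; case: (noX x) | | by move=> x; case: (noX x)].
  by apply/seteqP; split => x; case: (noX x).
- by move=> x; case: (noX x).
- by move=> x; case: (noX x).
Qed.
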